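(* Let $U$ be a non-degenerate linear recurrence sequence with values in a field of characteristic zero. Then $U$ admits at most finitely many twisted rational zeros.
   Context: For a field $\mathbb{K}$ of characteristic $0$, a $\mathbb{K}$-valued linear recurrence sequence (LRS) is a map $U:\mathbb{Z}\to\mathbb{K}$ with $U(n+m)=a_{m-1}U(n+m-1)+\dots+a_0U(n)$ for all $n$, $a_i\in\mathbb{K}$, $a_0\neq0$, $m$ minimal. With $\lambda_1,\dots,\lambda_s\in\overline{\mathbb{K}}$ the distinct roots of $X^m-a_{m-1}X^{m-1}-\dots-a_0$, $U(n)=f_1(n)\lambda_1^n+\dots+f_s(n)\lambda_s^n$ with nonzero polynomials $f_i$ over $\mathbb{K}(\lambda_1,\dots,\lambda_s)$. $U$ is non-degenerate if it is non-zero and $\lambda_k/\lambda_\ell$ is not a root of unity for $k\neq\ell$. For $a=k/\ell\in\mathbb{Q}$ in lowest terms with $\ell>0$, a determination of $\lambda_i^a$ is $\mu^k$ with $\mu\in\overline{\mathbb{K}}$, $\mu^\ell=\lambda_i$. A rational number $a$ is a twisted rational zero (TRZ) of $U$ if for some determinations of $\lambda_1^a,\dots,\lambda_s^a$ and some roots of unity $\xi_1,\dots,\xi_s\in\overline{\mathbb{K}}$ we have $\xi_1f_1(a)\lambda_1^a+\dots+\xi_sf_s(a)\lambda_s^a=0$. *)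

(* Defs.v *)
From HB Require Import structures.
From mathcomp Require Import all_boot all_order all_algebra.
From mathcomp Require Import boolp classical_sets cardinality.

Set Implicit Arguments.
Unset Strict Implicit.
Unset Printing Implicit Defensive.

Import GRing.Theory.

Local Open Scope ring_scope.

(* An algebraic closure of K is represented by a closed field L together with
   an embedding iota : K -> L over which every element of L is algebraic. *)
Definition algebraic_closure (K : fieldType) (L : closedFieldType)
    (iota : {rmorphism K -> L}) : Prop :=
  forall x : L, algebraicOver iota x.

(* The coefficient a 0 is required to be nonzero whenever it exists; order
   m = 0 is allowed and is that of the zero sequence. *)
Definition recurrence (K : fieldType) (U : int -> K) (m : nat)
    (a : 'I_m -> K) : Prop :=
  (forall i : 'I_m, i = 0%N :> nat -> a i != 0) /\
  (forall n : int, U (n + m%:Z) = \sum_(i < m) a i * U (n + i%:Z)).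

Definition minimal_recurrence (K : fieldType) (U : int -> K) (m : nat)
    (a : 'I_m -> K) : Prop :=
  recurrence U a /\
  (forall (m' : nat) (a' : 'I_m' -> K), recurrence U a' -> (m <= m')%N).

Definition is_lrs (K : fieldType) (U : int -> K) : Prop :=
  exists (m : nat) (a : 'I_m -> K), minimal_recurrence U a.

Definition charpoly (K : fieldType) (m : nat) (a : 'I_m -> K) : {poly K} :=
  'X^m - \sum_(i < m) a i *: 'X^i.

(* lam enumerates without repetition the roots in L of the characteristic
   polynomial of U. *)
Definition characteristic_roots (K : fieldType) (L : closedFieldType)
    (iota : {rmorphism K -> L}) (U : int -> K) (s : nat) (lam : 'I_s -> L)
    : Prop :=
  exists (m : nat) (a : 'I_m -> K),
    [/\ minimal_recurrence U a,
        injective lam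
      & forall x : L,
          root (map_poly iota (charpoly a)) x <-> exists i, x = lam i].

(* The subfield K(lam_1, ..., lam_s) of L; the rule for inverses needs no side
   condition because 0^-1 = 0. *)
Inductive adjoin (K : fieldType) (L : closedFieldType)
    (iota : {rmorphism K -> L}) (s : nat) (lam : 'I_s -> L) : L -> Prop :=
| adjoin_base (c : K) : adjoin iota lam (iota c)
| adjoin_gen (i : 'I_s) : adjoin iota lam (lam i)
| adjoin_sub (x y : L) :
    adjoin iota lam x -> adjoin iota lam y -> adjoin iota lam (x - y)
| adjoin_mul (x y : L) :
    adjoin iota lam x -> adjoin iota lam y -> adjoin iota lam (x * y)
| adjoin_inv (x : L) : adjoin iota lam x -> adjoin iota lam x^-1.

(* U(n) = f_1(n) lam_1^n + ... + f_s(n) lam_s^n for all n in Z; this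
   determines lam and f up to a common permutation of the indices. *)
Definition closed_form (K : fieldType) (L : closedFieldType)
    (iota : {rmorphism K -> L}) (U : int -> K) (s : nat) (lam : 'I_s -> L)
    (f : 'I_s -> {poly L}) : Prop :=
  [/\ characteristic_roots iota U lam,
      forall i, f i != 0,
      forall i j, adjoin iota lam (f i)`_j
    & forall n : int, iota (U n) = \sum_(i < s) (f i).[n%:~R] * lam i ^ n].

Definition is_root_of_unity (L : fieldType) (x : L) : Prop :=
  exists2 n : nat, (0 < n)%N & n.-unity_root x.

Definition lrs_nondegenerate (K : fieldType) (L : closedFieldType)
    (iota : {rmorphism K -> L}) (U : int -> K) : Prop :=
  (exists n : int, U n != 0) /\
  (forall (s : nat) (lam : 'I_s -> L), characteristic_roots iota U lam ->
     forall k l : 'I_s, k != l -> ~ is_root_of_unity (lam k / lam l)).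

(* numq r / denq r is r in lowest terms, with denq r > 0. *)
Definition determination (L : fieldType) (x : L) (r : rat) (y : L) : Prop :=
  exists2 mu : L, mu ^ denq r = x & y = mu ^ numq r.

Definition twisted_rational_zero (K : fieldType) (L : closedFieldType)
    (iota : {rmorphism K -> L}) (U : int -> K) : set rat :=
  fun r : rat =>
    exists (s : nat) (lam : 'I_s -> L) (f : 'I_s -> {poly L})
           (d xi : 'I_s -> L),
      [/\ closed_form iota U lam f,
          forall i, determination (lam i) r (d i),
          forall i, is_root_of_unity (xi i)
        & \sum_(i < s) xi i * (f i).[ratr r] * d i = 0].

(* Main.v *)
(* Finitely many elements of the field occur in the closed form of U, and
   they, together with all the roots occurring in one twisted zero, can be
   specialized to algebraic numbers without making a ratio lam_k / lam_l a root
   of unity.  Over a number field F, take a vanishing sum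
   sum_i f_i(a) x_i = 0, where x_i is a twisted determination of lam_i^a, and a
   minimal vanishing subsum.  Applying to it the powers of a Galois element
   fixing the roots of unity shows that each x_i / x_j lies in a cyclotomic
   extension of F; by Schinzel's commutation argument a bounded power of it is
   then, up to a root of unity, in F.  Hence lam_i / lam_j has, up to a bounded
   power and a root of unity, an l-th root in F, where l is the denominator of
   a, which bounds l because lam_i / lam_j is not a root of unity.  Once the
   denominator is bounded, the Galois elements raising roots of unity to powers
   in an arithmetic progression bound the order of the roots of unity in a
   minimal relation (Mann), and what remains is the Skolem-Mahler-Lech theorem
   for finitely many linear recurrences. *)

Require Import Defs.
From HB Require Import structures.
From mathcomp Require Import all_boot all_order all_algebra all_field.
From mathcomp Require Import boolp classical_sets cardinality.
(* Last, so that finset's set0, sub1set, etc. shadow those of classical_sets. *)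
From mathcomp Require Import fintype finset zify ring.

Set Implicit Arguments.
Unset Strict Implicit.
Unset Printing Implicit Defensive.

Import Order.TTheory GRing.Theory Num.Theory.

Local Open Scope ring_scope.

(** * Vandermonde elimination and exponential polynomials *)

(** Number fields enter as finite lists [s]: by Galois theory [fixed_by s x] says that [x] lies in
    the field generated by [s], and finiteness of its degree is used in the form that automorphisms
    have finitely many restrictions to [s]. The obstacle is uniformity. The roots of unity and
    radicals of a twisted zero have unbounded order [m], so the exponents [N] of
    [minrel_fixed_power] and [mann_bound] may depend only on [s] and the index type. An automorphism
    fixing [s] and acting on m-th roots of unity as z -> z^(1+h) lets the exponent m be replaced by
    gcd(h, m), and [h] can be chosen with this gcd bounded for all [m] because the field of [s]
    meets the cyclotomic fields in a bounded part. Minimality of a relation serves one purpose: a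
    Vandermonde argument splits a vanishing sum along the values of its twisting factors, so on a
    minimal sum these factors are all equal. The roots and coefficients are specialized before any
    zero is given, so that the finite list found over [algC] is the same for all zeros; each zero
    then only extends the specialization. *)

Section Vandermonde.
Variables (F : fieldType) (I : finType).
Implicit Types (A B : {set I}) (x t : I -> F).

(** The power sums combine to any polynomial in [t] of degree below [#|A|]. The polynomial [q]
    vanishing at all values of [t] other than [t i0] is short enough, since it has no factor for
    [i0]. *)
Lemma vandermonde_block A x t :
    (forall j, (j < #|A|)%N -> \sum_(i in A) x i * t i ^+ j = 0) ->
  forall i0, i0 \in A -> \sum_(i in A | t i == t i0) x i = 0.
Proof.
move=> sum0 i0 Ai0.
pose B := [set i in A | t i != t i0].
pose q := \prod_(i in B) ('X - (t i)%:P).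
have szq : (size q <= #|A|)%N.
  rewrite /q -big_enum size_prod_XsubC -cardE.
  apply: proper_card; apply/properP; split.
    by apply/subsetP=> i; rewrite inE => /andP[].
  by exists i0; rewrite // inE eqxx andbF.
have qi0 : q.[t i0] != 0.
  rewrite /q horner_prod; apply/prodf_neq0 => i.
  by rewrite inE hornerXsubC subr_eq0 eq_sym => /andP[].
have: \sum_(i in A) x i * q.[t i] = 0.
  under eq_bigr => i _ do rewrite (horner_coef_wide _ szq) mulr_sumr.
  rewrite exchange_big big1 //= => j _.
  under eq_bigr => i _ do rewrite mulrCA.
  by rewrite -mulr_sumr sum0 ?mulr0.
rewrite (bigID (fun i => t i == t i0)) /= [X in _ + X]big1 ?addr0; last first.
  move=> i /andP[Ai ti]; rewrite /q (bigD1 i) ?inE ?Ai //=.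
  by rewrite hornerM hornerXsubC subrr mul0r mulr0.
under eq_bigr => i /andP[_ /eqP->] do [].
by rewrite -mulr_suml => /eqP; rewrite mulf_eq0 (negPf qi0) orbF => /eqP.
Qed.

Definition minrel x A :=
  minset (fun B => (0 < #|B|)%N && (\sum_(i in B) x i == 0)) A.

Lemma minrel_exists x A :
    (0 < #|A|)%N -> \sum_(i in A) x i = 0 ->
  exists2 B, minrel x B & B \subset A.
Proof.
move=> A0 sA; have [|B minB sBA] := @minset_exists _
  (fun B : {set I} => (0 < #|B|)%N && (\sum_(i in B) x i == 0)) A.
  by rewrite A0 sA eqxx.
by exists B.
Qed.

Lemma minrel_sum x A : minrel x A -> \sum_(i in A) x i = 0.
Proof. by case/minsetp/andP=> _ /eqP. Qed.

Lemma minrel_const x t A :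
    minrel x A ->
    (forall j, (j < #|A|)%N -> \sum_(i in A) x i * t i ^+ j = 0) ->
  {in A &, forall i j, t i = t j}.
Proof.
move=> minA sum0 i j Ai Aj.
pose B := [set k in A | t k == t j].
have sB : \sum_(k in B) x k = 0.
  rewrite -[RHS](vandermonde_block sum0 Aj).
  by apply: eq_bigl => k; rewrite inE.
have BA : B \subset A by apply/subsetP=> k; rewrite inE => /andP[].
have Bj : j \in B by rewrite inE Aj eqxx.
have [_ minP] := minsetP minA.
have BE : B = A.
  by apply: minP => //; rewrite sB eqxx andbT; apply/card_gt0P; exists j.
by move: Ai; rewrite -BE inE => /andP[_ /eqP].
Qed.

End Vandermonde.

Section ExponentialPolynomials.
Variables (F : fieldType) (charF0 : [pchar F] =i pred0).

Lemma natr_inj_pchar0 : injective (fun n : nat => n%:R : F).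
Proof.
move=> m n /= mn; wlog le_mn : m n mn / (m <= n)%N.
  by move=> W; case/orP: (leq_total m n) => H; [exact: W | exact/esym/W].
have /(_ (n - m)%N) := (pcharf0P F).1 charF0.
by rewrite natrB // mn subrr eqxx => /esym/eqP; lia.
Qed.

Lemma poly_nat_roots_eq0 (p : {poly F}) (P : nat -> Prop) :
    (forall m, exists2 n, (m <= n)%N & P n) ->
    (forall n, P n -> p.[n%:R] = 0) ->
  p = 0.
Proof.
move=> infP p0; apply/eqP/negP => /negP nzp.
suff [s [us sp sP]] : exists s : seq nat,
    [/\ uniq s, size s = size p & forall n, n \in s -> P n].
  suff: (size [seq n%:R : F | n <- s] < size p)%N by rewrite size_map sp ltnn.
  apply: max_poly_roots => //.
    by apply/allP=> _ /mapP[n /sP Pn ->]; apply/rootP/p0.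
  by rewrite map_inj_uniq //; apply: natr_inj_pchar0.
elim: (size p) => [|k [s [us <- sP]]]; first by exists [::].
have [n len Pn] := infP (\max_(i <- s) i).+1.
exists (n :: s); split=> //=.
  rewrite us andbT; apply/negP => ns.
  by have := @leq_bigmax_seq _ s xpredT id n ns isT; rewrite leqNgt len.
by move=> i; rewrite inE => /predU1P[->|/sP].
Qed.

Lemma exp_poly_eq0 (I : finType) (A : {set I}) (lam : I -> F)
    (f : I -> {poly F}) :
    {in A &, injective lam} -> {in A, forall i, lam i != 0} ->
    (forall n : nat, \sum_(i in A) (f i).[n%:R] * lam i ^+ n = 0) ->
  {in A, forall i, f i = 0}.
Proof.
move=> lam_inj lam0.
have [N] := ubnP (\sum_(i in A) size (f i)); elim: N f => // N IH f leN sum0.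
case: (pickP (fun i => (i \in A) && (f i != 0))) => [i0 /andP[Ai0 nz0]|z i Ai].
  (* These are the coefficients of the sum at n+1 minus [lam i0] times the sum at n. The top term of
     [f i0] cancels, so the total size drops; elsewhere the leading coefficient is multiplied by
     [lam i - lam i0], so [g i = 0] forces [f i = 0]. *)
  pose g i := lam i *: (f i \Po ('X + 1%:P)) - lam i0 *: f i.
  have sz1 i : size (f i \Po ('X + 1%:P)) = size (f i).
    by rewrite size_comp_poly2 // size_XaddC.
  have lc1 i : lead_coef (f i \Po ('X + 1%:P)) = lead_coef (f i).
    by rewrite lead_coef_comp ?size_XaddC // lead_coefXaddC expr1n mulr1.
  have coef1 i : (g i)`_(size (f i)).-1 = (lam i - lam i0) * lead_coef (f i).
    by rewrite coefB !coefZ -{1}sz1 [X in _ * X - _]lc1 mulrBl.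
  have szg i : (size (g i) <= size (f i))%N.
    apply: leq_trans (size_polyD _ _) _; rewrite size_polyN geq_max.
    by rewrite !(leq_trans (size_scale_leq _ _)) ?sz1.
  have szg0 : (size (g i0) < size (f i0))%N.
    rewrite ltn_neqAle szg andbT; apply/eqP => e.
    have : lead_coef (g i0) = 0 by rewrite /lead_coef e coef1 subrr mul0r.
    by move/eqP; rewrite lead_coef_eq0 -size_poly_eq0 e size_poly_eq0 (negPf nz0).
  have g0 : {in A, forall i, g i = 0}.
    apply: IH => [|n].
      rewrite -ltnS; apply: leq_trans leN; rewrite ltnS.
      rewrite (bigD1 i0) //= [X in (_ < X)%N](bigD1 i0) //=.
      by rewrite -addSn leq_add ?leq_sum.
    transitivity (\sum_(i in A) (f i).[n.+1%:R] * lam i ^+ n.+1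
                  - lam i0 * \sum_(i in A) (f i).[n%:R] * lam i ^+ n).
      rewrite mulr_sumr -sumrB; apply: eq_bigr => i _.
      rewrite /g hornerD hornerN !hornerZ horner_comp hornerD hornerX hornerC.
      by rewrite -natr1 exprS; ring.
    by rewrite !sum0 mulr0 subrr.
  have f0 i : i \in A -> i != i0 -> f i = 0.
    move=> Ai ii0; apply/eqP; rewrite -lead_coef_eq0.
    have := coef1 i; rewrite g0 // coef0 => /esym/eqP.
    by rewrite mulf_eq0 subr_eq0 (inj_in_eq lam_inj) // (negPf ii0).
  suff e : f i0 = 0 by move: nz0; rewrite e eqxx.
  apply: (@poly_nat_roots_eq0 _ xpredT) => [m|n _]; first by exists m.
  have := sum0 n; rewrite (bigD1 i0) //= big1 ?addr0; last first.
    by move=> i /andP[Ai /(f0 i Ai) ->]; rewrite horner0 mul0r.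
  by move/eqP; rewrite mulf_eq0 expf_eq0 (negPf (lam0 _ Ai0)) andbF orbF => /eqP.
by apply/eqP/negPn/negP => nz; have := z i; rewrite Ai nz.
Qed.

End ExponentialPolynomials.

(** * Automorphisms of the algebraic numbers *)

Local Notation aut := {rmorphism algC -> algC}.

(** The roots of [minCpoly x] generate a splitting field, hence a normal one; a Galois element
    moving [x] to [y] there extends to [algC]. *)
Lemma minCpoly_conj x y : root (minCpoly x) y -> exists nu : aut, nu x = y.
Proof.
move=> ry; have [rs] := closed_field_poly_normal (minCpoly x).
rewrite (monicP (minCpoly_monic x)) scale1r => Drs.
have [Qs [QsC [s1 Ds1 genQs]]] := num_field_exists rs.
have [p [Dp mon_p] dv_p] := minCpolyP x.
pose p1 := map_poly (in_alg Qs) p.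
have p1C : map_poly QsC p1 = minCpoly x.
  rewrite Dp -map_poly_comp; apply: eq_map_poly => a /=.
  by rewrite alg_num_field fmorph_rat.
have Dp1 : p1 = \prod_(z <- s1) ('X - z%:P).
  apply: (map_poly_inj QsC); rewrite p1C Drs -Ds1 big_map rmorph_prod /=.
  by apply: eq_bigr => z _; rewrite map_polyXsubC.
have F0p1 : p1 \is a polyOver 1%VS by apply/polyOver1P; exists p.
have splitQs : SplittingField.axiom Qs.
  exists p1 => //; exists s1; first by rewrite Dp1 eqpxx.
  exact: genQs.
pose Qm := FieldExt_isSplittingField.Build rat Qs splitQs.
pose Qn : splittingFieldType rat := HB.pack Qs Qm.
have memC z : root (minCpoly x) z -> exists2 z1 : Qn, QsC z1 = z & z1 \in s1.
  by rewrite Drs root_prod_XsubC -Ds1 => /mapP[z1 ? ->]; exists z1.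
have [x1 Dx _] := memC x (root_minCpoly x).
have [y1 Dy _] := memC y ry.
have rm : root (minPoly (1%AS : {subfield Qn}) x1) y1.
  have /polyOver1P[q Dq] := minPolyOver (1%AS : {subfield Qn}) x1.
  have qC : map_poly QsC (map_poly (in_alg Qs) q) = map_poly ratr q.
    rewrite -map_poly_comp; apply: eq_map_poly => a /=.
    by rewrite alg_num_field fmorph_rat.
  have : root (map_poly ratr q) x.
    by rewrite -qC -Dx fmorph_root -Dq root_minPoly.
  rewrite dv_p => /dvdpP[r Dr].
  rewrite Dq -(fmorph_root QsC) qC Dr rmorphM rootM /= -Dp.
  by apply/orP; right; rewrite Dy.
have [g _ gx] := normalField_root_minPoly (sub1v {:Qn}%AS)
  (normalFieldf 1%AS) (memvf x1) rm.
have [nu Dnu] := @extend_algC_subfield_aut Qn QsC g.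
by exists nu; rewrite -Dx -Dnu -Dy -gx.
Qed.

(** All roots of [minCpoly x] equal [x], so its subleading coefficient, which is rational, is a
    nonzero integer multiple of [x]. *)
Lemma aut_fixed_rat x : (forall nu : aut, nu x = x) -> x \in Crat.
Proof.
move=> fx; have [rs] := closed_field_poly_normal (minCpoly x).
rewrite (monicP (minCpoly_monic x)) scale1r => Drs.
have rsx y : y \in rs -> y = x.
  by rewrite -root_prod_XsubC -Drs => /minCpoly_conj[nu <-].
have rs0 : size rs != 0%N.
  by have := size_minCpoly x; rewrite Drs size_prod_XsubC ltnS lt0n.
have [p [Dp _] _] := minCpolyP x.
have := coefPn_prod_XsubC rs0; rewrite -Drs Dp coef_map /= big_seq.
rewrite (eq_bigr _ (fun y ry => rsx y ry)) -big_seq.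
rewrite big_const_seq count_predT iter_addr_0.
move=> /(congr1 (fun z => - z / (size rs)%:R)).
rewrite opprK -(mulr_natr x) mulfK ?pnatr_eq0 // => <-.
by rewrite rpredM ?rpredN ?Crat_rat // rpredV rpred_nat.
Qed.

Definition fixes (nu : aut) (s : seq algC) := {in s, forall x, nu x = x}.

Definition fixed_by (s : seq algC) (x : algC) :=
  forall nu : aut, fixes nu s -> nu x = x.

Lemma fixed_by_mem s x : x \in s -> fixed_by s x.
Proof. by move=> sx nu; apply. Qed.

Lemma fixed_byM s x y : fixed_by s x -> fixed_by s y -> fixed_by s (x * y).
Proof. by move=> fx fy nu f; rewrite rmorphM /= fx ?fy. Qed.

Lemma fixed_byV s x : fixed_by s x -> fixed_by s x^-1.
Proof. by move=> fx nu f; rewrite fmorphV /= fx. Qed.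

Lemma fixed_byX s x n : fixed_by s x -> fixed_by s (x ^+ n).
Proof. by move=> fx nu f; rewrite rmorphXn /= fx. Qed.

Lemma fixed_by_rat s a : fixed_by s (ratr a).
Proof. by move=> nu _; rewrite fmorph_rat. Qed.

Lemma fixed_by_horner s (p : {poly algC}) x :
  (forall i, fixed_by s p`_i) -> fixed_by s x -> fixed_by s p.[x].
Proof.
move=> fp fx nu f; rewrite horner_coef rmorph_sum; apply: eq_bigr => i _.
by rewrite rmorphM rmorphXn /= fp ?fx.
Qed.

Lemma fixes_agree s (nu mu : aut) :
  {in s, nu =1 mu} -> fixes (algC_invaut mu \o nu) s.
Proof. by move=> e x sx /=; rewrite e // algC_autK. Qed.

Lemma fixed_by_agree s (nu mu : aut) x :
  fixed_by s x -> {in s, nu =1 mu} -> nu x = mu x.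
Proof.
move=> fx e; apply: (can_inj (algC_autK (algC_invaut mu))).
exact: etrans (fx _ (fixes_agree e)) (esym (algC_autK _ _)).
Qed.

Lemma aut_unity (nu : aut) n z : z ^+ n = 1 -> nu z ^+ n = 1.
Proof. by move=> z1; rewrite -rmorphXn z1 rmorph1. Qed.

(** Cyclotomic extensions are abelian: both automorphisms act on a primitive root by taking
    powers. *)
Lemma aut_unity_comm (nu mu : aut) n z :
  (0 < n)%N -> z ^+ n = 1 -> nu (mu z) = mu (nu z).
Proof.
move=> n0; have [w wP] := C_prim_root_exists n0.
have wn := prim_expr_order wP.
move=> /(prim_rootP wP)[i ->].
have /(prim_rootP wP)[j nuw] := aut_unity nu wn.
have /(prim_rootP wP)[k muw] := aut_unity mu wn.
by rewrite !rmorphXn /= muw nuw !rmorphXn /= nuw muw -!exprM; congr (_ ^+ _);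
  lia.
Qed.

(** The bound stands in for the degree of the field generated by [s]: on [s] an automorphism only
    chooses a conjugate of each element. *)
Lemma aut_pigeonhole (s : seq algC) : exists N, forall k (tau : 'I_k -> aut),
  (forall i j, {in s, tau i =1 tau j} -> i = j) -> (k <= N)%N.
Proof.
pose R := flatten [seq sval (closed_field_poly_normal (minCpoly x)) | x <- s].
have memR (nu : aut) x : x \in s -> nu x \in R.
  move=> sx; apply/flattenP; eexists; first exact: map_f sx.
  case: (closed_field_poly_normal _) => rs /= Drs.
  rewrite -root_prod_XsubC -(rootZ _ _ (_ : lead_coef (minCpoly x) != 0)) -?Drs.
    by rewrite -(minCpoly_aut nu) root_minCpoly.
  by rewrite lead_coef_eq0 minCpoly_eq0.
pose ty (nu : aut) : (size s).-tuple (seq_sub R) :=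
  [tuple SeqSub (memR nu _ (mem_tnth i (in_tuple s))) | i < size s].
have tyP nu mu : ty nu = ty mu -> {in s, nu =1 mu}.
  move=> e x sx; have xs : (index x s < size s)%N by rewrite index_mem.
  have := congr1 (fun t => val (tnth t (Ordinal xs))) e.
  by rewrite /= !tnth_mktuple /= (tnth_nth 0) /= nth_index.
exists #|{: (size s).-tuple (seq_sub R)}| => k tau sep.
by rewrite -(card_ord k);
  apply: (@leq_card _ _ (fun i => ty (tau i))) => i j /tyP/sep.
Qed.

(** * The field generated by [s] against cyclotomic fields *)

Section Conductor.
Variable s : seq algC.

(** Equality of cosets of the stabiliser of [s], inside the group of automorphisms acting on the
    f-th roots of unity. *)
Let equiv f (tau tau' : aut) :=
  exists2 nu : aut, fixes nu s & forall z, z ^+ f = 1 -> tau' z = tau (nu z).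

Let equiv_sym f tau tau' : equiv f tau tau' -> equiv f tau' tau.
Proof.
move=> [nu fnu e]; exists (algC_invaut nu) => [x sx|z z1].
  by rewrite -{1}(fnu x sx); apply: algC_autK.
by rewrite e ?(aut_unity (algC_invaut nu)) //; congr (tau _);
  apply/esym/algC_invautK.
Qed.

Let separated k := exists2 f, (0 < f)%N & exists tau : 'I_k -> aut,
  forall i j, equiv f (tau i) (tau j) -> i = j.

(** Automorphisms that agree on [s] differ by one fixing [s], hence are equivalent for every [f];
    inequivalent ones have distinct restrictions to [s]. *)
Let separated_bounded : exists N, forall k, separated k -> (k <= N)%N.
Proof.
have [N leN] := aut_pigeonhole s; exists N => k [f _ [tau sep]].
apply: (leN k tau) => i j e; apply: sep; exists (algC_invaut (tau i) \o tau j).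
  by apply: fixes_agree => x sx; rewrite e.
by move=> z _ /=; rewrite algC_invautK.
Qed.

(* [f] is a modulus at which the number of cosets of the stabiliser of [s],
   acting on the [f]-th roots of unity, is maximal. *)
Lemma conductor : exists2 f, (0 < f)%N & forall m (tau : aut), (0 < m)%N ->
    (forall z, z ^+ f = 1 -> tau z = z) ->
  exists2 nu : aut, fixes nu s & forall z, z ^+ m = 1 -> nu z = tau z.
Proof.
have [N leN] := separated_bounded.
have ex1 : exists k, `[< separated k >].
  by exists 0%N; apply/asboolP; exists 1%N => //; exists (fun=> idfun) => -[].
have [k /asboolP sepk maxk] := ex_maxnP ex1 (fun k H => leN k (asboolW H)).
have [f f0 [tau sep]] := sepk.
case: k => [|k] in tau sep maxk sepk *.
  suff : separated 1 by move/asboolP/maxk.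
  by exists 1%N => //; exists (fun=> idfun) => i j _; rewrite !ord1.
(* Adding [t \o tau ord0] to the old representatives gives one too many modulo [M], so two are
   equivalent there. The old ones are inequivalent already modulo [f], so the new one is involved;
   modulo [f], where [t] is trivial, its partner must be [tau ord0], and the equivalence supplies
   [nu]. *)
exists f => // m t m0 tf; pose M := (f * m)%N.
have M0 : (0 < M)%N by rewrite muln_gt0 f0.
have toM z : z ^+ f = 1 -> z ^+ M = 1 by rewrite exprM => ->; rewrite expr1n.
pose tau' (o : 'I_k.+2) : aut :=
  if unlift ord0 o is Some i then tau i else t \o tau ord0.
have key i : equiv M (tau i) (t \o tau ord0) ->
    exists2 nu : aut, fixes nu s & forall z, z ^+ m = 1 -> nu z = t z.
  move=> [nu fnu e]; have i0 : i = ord0.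
    apply: sep; exists nu => // z zf; rewrite -e ?toM //=.
    by rewrite tf // (aut_unity (tau ord0)).
  exists nu => // z zm; have zM : z ^+ M = 1.
    by rewrite /M mulnC exprM zm expr1n.
  apply: (fmorph_inj (tau ord0)); rewrite -[in LHS]i0 -e //=.
  by rewrite (aut_unity_comm _ _ M0 zM).
case: (pselect (forall i j, equiv M (tau' i) (tau' j) -> i = j)) => [all|].
  have /asboolP/maxk : separated k.+2 by exists M => //; exists tau'.
  by rewrite ltnn.
move=> /existsNP[i /existsNP[j /not_implyP[eij nij]]].
move: eij nij; rewrite /tau'.
case: unliftP => [i' ->|->]; case: unliftP => [j' ->|->] eij nij.
- case: nij; congr (lift _ _); apply: sep; have [nu fnu e] := eij.
  by exists nu => // z zf; rewrite e ?toM.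
- exact: key eij.
- exact: key (equiv_sym eij).
- by case: nij.
Qed.

End Conductor.

(** * Minimal relations between radicals and roots of unity *)

Section Progression.
Local Open Scope nat_scope.

Lemma eqn_mod_dvd_trans d m a b : d %| m -> a = b %[mod m] -> a = b %[mod d].
Proof. by move=> dm e; rewrite -(modn_dvdm a dm) e modn_dvdm. Qed.

(** Take [h] congruent to c = f * n! on the part of [m] built from primes dividing [c], and to 1 on
    the rest. A prime of the first kind divides [h]; one of the second kind exceeds [n], and 1 + h *
    y is congruent to 1 + y <= n there. The second part is prime to [h], so the gcd divides [c]. *)
Lemma coprime_progression f n m : 0 < f -> 0 < m -> f %| m ->
  exists h, [/\ f %| h, gcdn h m %| f * n`!
              & forall y, y < n -> coprime (1 + h * y) m].
Proof.
move=> f0 m0 fm; set c := f * n`!.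
have c0 : 0 < c by rewrite muln_gt0 f0 fact_gt0.
pose pi := \pi(c); pose m1 := m`_pi; pose m2 := m`_(pi^').
have m12 : m1 * m2 = m by rewrite partnC.
have co12 : coprime m1 m2 by rewrite coprime_partC.
pose h := chinese m1 m2 c 1.
have hm1 : h = c %[mod m1] by rewrite /h chinese_modl.
have hm2 : h = 1 %[mod m2] by rewrite /h chinese_modr.
have fc : f %| c by rewrite dvdn_mulr.
have fm1 : f %| m1.
  have <- : f`_pi = f.
    apply: part_pnat_id; apply: sub_in_pnat (pnat_pi f0) => p _.
    exact: pi_of_dvd fc c0 p.
  exact: partn_dvd.
exists h; split.
- by rewrite /dvdn (eqn_mod_dvd_trans fm1 hm1).
- have coh : coprime h m2 by rewrite /coprime -gcdn_modl hm2 gcdn_modl gcd1n.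
  by rewrite -m12 Gauss_gcdl // -gcdn_modl hm1 gcdn_modl; exact: dvdn_gcdl.
move=> y yn; rewrite /coprime; apply/negPn/negP => g1.
have [|p pp] := @pdivP (gcdn (1 + h * y) m).
  by have := gcdn_gt0 (1 + h * y) m; lia.
rewrite dvdn_gcd -m12 Euclid_dvdM // => /andP[p1 /orP[pm|pm]].
  have pc : p \in pi.
    apply: (pnatPpi (part_pnat pi m)).
    by rewrite mem_primes pp pm part_gt0.
  have ph : p %| h.
    rewrite /dvdn (eqn_mod_dvd_trans pm hm1) -/(p %| c).
    by move: pc; rewrite mem_primes => /and3P[].
  by move: p1; rewrite dvdn_addl ?dvdn_mulr // dvdn1 => /eqP p1; move: pp;
    rewrite p1.
have pc : p \in pi^'.
  apply: (pnatPpi (part_pnat pi^' m)).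
  by rewrite mem_primes pp pm part_gt0.
have pn : ~~ (p %| n`!).
  apply: contraL pc => pn; rewrite inE /= negbK mem_primes pp c0 /=.
  exact: dvdn_mull.
have np : n < p by rewrite ltnNge; apply: contra pn => pn;
  rewrite dvdn_fact ?prime_gt0.
have : p %| 1 + y.
  rewrite /dvdn -(modnDmr 1 y) -[X in (1 + X %% p) %% p]mul1n.
  rewrite -modnMml -(eqn_mod_dvd_trans pm hm2) modnMml modnDmr.
  exact: p1.
by move/dvdn_leq => /(_ isT); rewrite leqNgt add1n (leq_ltn_trans yn np).
Qed.

End Progression.

(** An exponent congruent to 1 modulo the conductor [f] is realized by an automorphism trivial on
    f-th roots of unity, which [conductor] replaces by one fixing [s] with the same action on m-th
    roots of unity. Working modulo m * f makes [f] divide the modulus. [N] is chosen before [m]. *)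
Lemma fixing_progression s n : exists2 N, (0 < N)%N &
  forall m, (0 < m)%N -> exists2 h, (gcdn h m %| N)%N &
  forall y, (y < n)%N -> exists2 nu : aut, fixes nu s &
  forall z, z ^+ m = 1 -> nu z = z ^+ (1 + h * y).
Proof.
have [f f0 fP] := conductor s.
exists (f * n`!)%N; first by rewrite muln_gt0 f0 fact_gt0.
move=> m m0; have M0 : (0 < m * f)%N by rewrite muln_gt0 m0.
have [h [fh gh hP]] := coprime_progression n f0 M0 (dvdn_mull m (dvdnn f)).
exists h.
  by apply: dvdn_trans gh; rewrite dvdn_gcd dvdn_gcdl dvdn_mulr ?dvdn_gcdr.
move=> y /hP co; have [tau tauP] := Qn_aut_exists co.
have [z zf|nu fnu nuP] := fP m tau m0.
  rewrite tauP; last by rewrite mulnC exprM zf expr1n.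
  have [k ->] := dvdnP fh.
  by rewrite exprD expr1 mulnAC mulnC exprM zf expr1n mulr1.
exists nu => // z zm; rewrite nuP // tauP //.
by rewrite exprM zm expr1n.
Qed.

Definition torsion (R : fieldType) (x : R) := exists2 n, (0 < n)%N & x ^+ n = 1.

Section Kummer.
Variables (s : seq algC) (I : finType) (A : {set I}) (c theta : I -> algC).
Variable m : nat.
Hypotheses (m_gt0 : (0 < m)%N)
  (fixed_c : forall i, i \in A -> fixed_by s (c i))
  (theta0 : forall i, i \in A -> theta i != 0)
  (fixed_theta : forall i, i \in A -> fixed_by s (theta i ^+ m))
  (minA : minrel (fun i => c i * theta i) A).

(** Each factor nu(theta i) / theta i is an m-th root of unity, hence fixed by [nu]; iterating [nu]
    on the relation multiplies its terms by powers of these factors, which minimality makes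
    equal. *)
Lemma kummer_ratio_fixed (nu : aut) :
    fixes nu s -> (forall z, z ^+ m = 1 -> nu z = z) ->
  {in A &, forall i j, nu (theta i / theta j) = theta i / theta j}.
Proof.
move=> fnu nu1; pose t i := nu (theta i) / theta i.
have nut i : i \in A -> nu (t i) = t i.
  move=> Ai; apply: nu1; rewrite expr_div_n -rmorphXn fixed_theta //.
  by rewrite divff // expf_neq0 ?theta0.
have sum0 j : \sum_(i in A) c i * theta i * t i ^+ j = 0.
  elim: j => [|j IH].
    by under eq_bigr => i _ do rewrite expr0 mulr1; exact: minrel_sum minA.
  apply: etrans (etrans (congr1 nu IH) (rmorph0 nu)).
  rewrite rmorph_sum; apply: eq_bigr => i Ai.
  rewrite !rmorphM rmorphXn /= nut // (fixed_c Ai) // exprS.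
  rewrite -[nu (theta i)](divfK (theta0 Ai)) -/(t i); ring.
move=> i j Ai Aj; have := minrel_const minA (fun k _ => sum0 k) Ai Aj.
rewrite /t fmorph_div => e.
rewrite -[nu (theta i)](divfK (theta0 Ai)) e -[X in _ / X](divfK (theta0 Aj)).
have n0 : nu (theta j) / theta j != 0.
  by rewrite mulf_neq0 ?invr_eq0 ?fmorph_eq0 ?theta0.
by rewrite -mulf_div divff // mul1r.
Qed.

End Kummer.

(* Schinzel: the Galois group of an abelian extension is commutative, so the
   cocycle [nu theta / theta] becomes a coboundary after raising to the
   power [h]. *)
Lemma schinzel_twist s m theta h (sigma : aut) :
    (0 < m)%N -> theta != 0 -> fixed_by s (theta ^+ m) ->
    (forall nu : aut, fixes nu s -> (forall z, z ^+ m = 1 -> nu z = z) ->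
      nu theta = theta) ->
    fixes sigma s -> (forall z, z ^+ m = 1 -> sigma z = z ^+ (1 + h)) ->
  fixed_by s (theta ^+ h / (sigma theta / theta)).
Proof.
move=> m0 t0 ftm abel fs sP tau ft.
have unit1 (nu : aut) : fixes nu s -> (nu theta / theta) ^+ m = 1.
  move=> fnu; rewrite expr_div_n -rmorphXn ftm // divff // expf_neq0 //.
have comm : sigma (tau theta) = tau (sigma theta).
  (* This commutator fixes [s] and, by [aut_unity_comm], all m-th roots of unity; by [abel] it fixes
     [theta]. *)
  pose mu : aut := algC_invaut (tau \o sigma) \o (sigma \o tau).
  have mut : mu theta = theta.
    apply: abel => [|z zm].
      by apply: fixes_agree => x sx /=; rewrite ft // !fs // ft.
    apply: etrans (algC_autK (tau \o sigma) z).
    by congr (algC_invaut _ _); apply: aut_unity_comm zm.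
  by rewrite -[in RHS]mut; apply/esym/(algC_invautK (tau \o sigma)).
set chi := sigma theta / theta; set chi' := tau theta / theta.
have st : sigma theta = chi * theta by rewrite divfK.
have tt : tau theta = chi' * theta by rewrite divfK.
have chi0 : chi != 0 by rewrite mulf_neq0 ?invr_eq0 ?fmorph_eq0.
have chi'0 : chi' != 0 by rewrite mulf_neq0 ?invr_eq0 ?fmorph_eq0.
have e : tau chi = chi * chi' ^+ h.
  apply: (mulIf chi'0); apply: (mulIf t0);
    rewrite -mulrA -tt -rmorphM -st -comm.
  rewrite tt rmorphM /= (sP chi') ?unit1 // st exprD expr1; ring.
rewrite fmorph_div rmorphXn /= tt e exprMn invfM.
by field; rewrite chi0 expf_neq0.
Qed.

(** Bezout: [theta ^+ m] and, up to the root of unity [chi], [theta ^+ h] are both in the field, so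
    [theta] to the power gcd(h, m) is too, up to a root of unity. *)
Lemma fixed_root_gcd s m theta h chi :
    theta != 0 -> (0 < m)%N -> fixed_by s (theta ^+ m) -> torsion chi ->
    fixed_by s (theta ^+ h / chi) ->
  forall N, (gcdn h m %| N)%N ->
  exists2 zeta, torsion zeta & fixed_by s (zeta * theta ^+ N).
Proof.
move=> t0 m0 fm [r r0 chi1] fh N /dvdnP[q ->].
have chi0 : chi != 0.
  by apply/eqP => z; move/eqP: chi1;
    rewrite z expr0n (gtn_eqF r0) eq_sym oner_eq0.
case: (egcdnP h m0) => km kn e _; rewrite gcdnC.
exists (chi ^+ (kn * q)).
  by exists r => //; rewrite exprAC chi1 expr1n.
suff -> : chi ^+ (kn * q) * theta ^+ (q * gcdn m h)
          = ((theta ^+ m) ^+ km / (theta ^+ h / chi) ^+ kn) ^+ q.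
  apply: fixed_byX; apply: fixed_byM; first exact: fixed_byX.
  by apply: fixed_byV; apply: fixed_byX.
rewrite [(q * _)%N]mulnC !exprM -exprMn; congr (_ ^+ q).
rewrite -!exprM (mulnC m) e exprD expr_div_n -exprM (mulnC h).
by field; rewrite !expf_neq0.
Qed.

Theorem minrel_fixed_power s (I : finType) : exists2 N, (0 < N)%N &
  forall (A : {set I}) (c theta : I -> algC) m, (0 < m)%N ->
    (forall i, i \in A -> fixed_by s (c i)) ->
    (forall i, i \in A -> theta i != 0) ->
    (forall i, i \in A -> fixed_by s (theta i ^+ m)) ->
    minrel (fun i => c i * theta i) A ->
  {in A &, forall i j,
    exists2 zeta, torsion zeta & fixed_by s (zeta * (theta i / theta j) ^+ N)}.
Proof.
(* Length 2 admits y = 1, that is, the exponent 1 + h required by [schinzel_twist]. *)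
have [N N0 NP] := fixing_progression s 2; exists N => // A c theta m m0.
move=> fc t0 fm minA i j Ai Aj; have [h hN /(_ 1 isT)[nu fnu nuP]] := NP m m0.
rewrite muln1 in nuP; set th := theta i / theta j.
have th0 : th != 0 by rewrite mulf_neq0 ?invr_eq0 ?t0.
have thm : fixed_by s (th ^+ m).
  by rewrite expr_div_n; apply: fixed_byM; [|apply: fixed_byV]; apply: fm.
apply: (fixed_root_gcd (h := h) (chi := nu th / th)) hN => //.
  exists m => //.
  by rewrite expr_div_n -rmorphXn thm // divff // expf_neq0.
apply: (schinzel_twist m0) => // mu fmu mu1.
exact: (kummer_ratio_fixed fc t0 fm minA).
Qed.

(** The automorphism of index [y] multiplies [xi k] by the y-th power of [xi k ^+ h], so progression
    length [#|I|] provides all the power sums that the Vandermonde argument needs. Thus [xi k ^+ h]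
    is constant, and the order of a ratio divides gcd(h, m), a divisor of [N]. *)
Theorem mann_bound s (I : finType) : exists2 N, (0 < N)%N &
  forall (A : {set I}) (c xi : I -> algC) m, (0 < m)%N ->
    (forall i, i \in A -> fixed_by s (c i)) ->
    (forall i, i \in A -> xi i ^+ m = 1) ->
    minrel (fun i => c i * xi i) A ->
  {in A &, forall i j, (xi i / xi j) ^+ N = 1}.
Proof.
have [N N0 NP] := fixing_progression s #|I|; exists N => // A c xi m m0.
move=> fc xm minA i j Ai Aj; have [h /dvdnP[q ->] hP] := NP m m0.
have xi0 k : k \in A -> xi k != 0.
  move=> Ak; apply/eqP => z; have /eqP := xm k Ak.
  by rewrite z expr0n (gtn_eqF m0) eq_sym oner_eq0.
have eh : (xi i / xi j) ^+ h = 1.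
  suff e : xi i ^+ h = xi j ^+ h.
    by rewrite expr_div_n e divff // expf_neq0 ?xi0.
  apply: (minrel_const (t := fun k => xi k ^+ h) minA) => // y yA.
  have [|nu fnu nuP] := hP y; first exact: leq_trans yA (max_card _).
  apply: etrans (etrans (congr1 nu (minrel_sum minA)) (rmorph0 nu)).
  rewrite rmorph_sum; apply: eq_bigr => k Ak;
    rewrite rmorphM /= fc // nuP ?xm //.
  by rewrite exprD expr1 exprM mulrA.
have em : (xi i / xi j) ^+ m = 1 by rewrite expr_div_n !xm // divr1.
case: (egcdnP h m0) => km kn e _.
rewrite mulnC exprM gcdnC;
  suff -> : (xi i / xi j) ^+ gcdn m h = 1 by rewrite expr1n.
have := congr1 (fun k => (xi i / xi j) ^+ k) e.
by rewrite exprD ![(_ * m)%N]mulnC ![(_ * h)%N]mulnC !exprM em eh !expr1n mul1r.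
Qed.

(** * Extraction of roots in a number field *)

Section Torsion.
Variable R : fieldType.
Implicit Types x y : R.

Lemma torsion_neq0 x : torsion x -> x != 0.
Proof.
case=> n n0 x1; apply/eqP => z; move/eqP: x1.
by rewrite z expr0n (gtn_eqF n0) eq_sym oner_eq0.
Qed.

Lemma torsionM x y : torsion x -> torsion y -> torsion (x * y).
Proof.
move=> [n n0 x1] [m m0 y1]; exists (n * m)%N; first by rewrite muln_gt0 n0.
by rewrite exprMn exprM x1 mulnC exprM y1 !expr1n mulr1.
Qed.

Lemma torsionV x : torsion x -> torsion x^-1.
Proof. by move=> [n n0 x1]; exists n => //; rewrite exprVn x1 invr1. Qed.

Lemma torsion_div x y : torsion x -> torsion y -> torsion (x / y).
Proof. by move=> tx /torsionV; apply: torsionM. Qed.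

Lemma torsionX x k : torsion x -> torsion (x ^+ k).
Proof. by move=> [n n0 x1]; exists n => //; rewrite exprAC x1 expr1n. Qed.

Lemma torsion_root x k : (0 < k)%N -> torsion (x ^+ k) -> torsion x.
Proof.
move=> k0 [n n0 x1]; exists (k * n)%N; first by rewrite muln_gt0 k0.
by rewrite exprM.
Qed.

End Torsion.

Lemma common_torsion_exponent (R : fieldType) (I : finType) (z : I -> R) :
  (forall i, torsion (z i)) -> exists2 m, (0 < m)%N & forall i, z i ^+ m = 1.
Proof.
move=> tz; have ex i : exists n, (0 < n)%N /\ z i ^+ n = 1.
  by have [n] := tz i; exists n.
have [n_ nP] := choice ex; exists (\prod_i n_ i)%N.
  by apply: prodn_gt0 => i; case: (nP i).
by move=> i; rewrite (bigD1 i) //= exprM (nP i).2 expr1n.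
Qed.

Lemma torsion_norm (x : algC) : torsion x -> `|x| = 1.
Proof.
move=> [n n0 x1]; apply/eqP; rewrite -(pexpr_eq1 n0) ?normr_ge0 //.
by rewrite -normrX x1 normr1.
Qed.

Lemma torsion_Aint (x : algC) : torsion x -> x \in Aint.
Proof. by move=> [n n0 x1]; apply: (Aint_unity_root n0); apply/unity_rootP. Qed.

Lemma torsion_rmorph (K L : fieldType) (nu : {rmorphism K -> L}) x :
  torsion x -> torsion (nu x).
Proof. by move=> [n n0 x1]; exists n => //; rewrite -rmorphXn x1 rmorph1. Qed.

Lemma Aint_root (x : algC) l : (0 < l)%N -> x ^+ l \in Aint -> x \in Aint.
Proof.
move=> l0 ax; apply: (@root_monic_Aint (minCpoly (x ^+ l) \Po 'X^l)).
- by rewrite /root horner_comp hornerXn; apply: root_minCpoly.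
- rewrite monicE lead_coef_comp ?size_polyXn // lead_coefXn expr1n mulr1.
  by rewrite -monicE minCpoly_monic.
- by apply: polyOver_comp; rewrite // rpredX ?polyOverX.
Qed.

Lemma Aint_nat n : n%:R \in Aint.
Proof. exact: rpred_nat. Qed.

Lemma Aint_denominator (x : algC) : exists2 D, (0 < D)%N & D%:R * x \in Aint.
Proof.
have [p [Dp mp] _] := minCpolyP x.
have [q [a a0 Dq]] := rat_poly_scale p.
have pint i : p`_i * a%:~R = (q`_i)%:~R.
  by rewrite Dq coefZ coef_map /= mulrAC mulVf ?mul1r // intr_eq0.
suff ax : a%:~R * x \in Aint.
  exists `|a|%N; first by rewrite absz_gt0.
  by case: (intP a) ax => [|n|n]; rewrite ?abszN //= rmorphN mulNr rpredN.
pose n := (size p).-1.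
have sp : size p = n.+1 by rewrite prednK // size_poly_gt0 monic_neq0.
(* [r] is a^n p(X/a): monic, vanishing at a * x, and with integer coefficients because one factor
   [a] already clears each coefficient of [p]. *)
pose r := \poly_(i < n.+1) (ratr (p`_i * a%:~R ^+ (n - i)) : algC).
have rn : r`_n = 1.
  rewrite coef_poly leqnn subnn expr0 mulr1.
  by rewrite -/(lead_coef p) (monicP mp) rmorph1.
apply: (@root_monic_Aint r).
- rewrite /root horner_poly.
  have -> : \sum_(i < n.+1) ratr (p`_i * a%:~R ^+ (n - i)) * (a%:~R * x) ^+ i
            = a%:~R ^+ n * (minCpoly x).[x].
    rewrite Dp horner_coef size_map_poly sp mulr_sumr; apply: eq_bigr => i _.
    rewrite coef_map rmorphM rmorphXn /= ratr_int exprMn.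
    have -> : a%:~R ^+ n = a%:~R ^+ (n - i) * a%:~R ^+ i :> algC.
      by rewrite -exprD subnK // -ltnS.
    ring.
  by rewrite (rootP (root_minCpoly x)) mulr0.
- rewrite monicE /lead_coef (_ : size r = n.+1) ?rn //.
  apply/eqP; rewrite eqn_leq size_poly ltnNge.
  by apply/negP => /leq_sizeP/(_ n (leqnn n))/eqP; rewrite rn oner_eq0.
- apply/polyOverP => i; rewrite coef_poly; case: ltnP => ni; last exact: rpred0.
  have [->|ni'] := eqVneq i n.
    have := rn; rewrite coef_poly leqnn => ->; exact: rpred1.
  have {}ni : (i < n)%N by rewrite ltn_neqAle ni' -ltnS.
  have -> : (n - i)%N = (n - i).-1.+1 by rewrite prednK // subn_gt0.
  by rewrite exprS mulrA pint rmorphM rmorphXn /= !ratr_int rpredM ?rpredX ?rpred_int.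
Qed.

Lemma coef_prod_XsubC_norm (C : seq algC) (B : algC) k : 0 <= B ->
    (forall c, c \in C -> `|c| <= B) ->
  `|(\prod_(c <- C) ('X - c%:P))`_k| <= (1 + B) ^+ size C.
Proof.
move=> B0; elim: C k => [|c C IH] k leB.
  by rewrite big_nil coef1 expr0; case: eqP => _;
    rewrite ?normr1 ?normr0 ?ler01.
have {}IH j := IH j (fun d Cd => leB d (@mem_behead _ (c :: C) d Cd)).
rewrite big_cons mulrBl coefB coefXM coefCM /= exprS mulrDl mul1r.
apply: le_trans (ler_normB _ _) _; apply: lerD.
  by case: eqP => // _; rewrite normr0 exprn_ge0 // addr_ge0.
by rewrite normrM ler_pM // leB // mem_head.
Qed.

(** Northcott finiteness. The product of the X - c over the conjugates c of [z] is invariant and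
    integral, so it has integer coefficients; these are at most M = (1 + B)^d in absolute value. The
    polynomials [P a] list all candidates, with coefficients shifted by [M] to be naturals. *)
Lemma Aint_bounded_finite (d B : nat) : exists Om : seq algC, forall z : algC,
    z \in Aint ->
    (forall C, uniq C -> (forall c, c \in C -> exists nu : aut, nu z = c) ->
       (size C <= d)%N) ->
    (forall nu : aut, `|nu z| <= B%:R) ->
  z \in Om.
Proof.
pose M := ((1 + B) ^ d)%N.
pose P (a : {ffun 'I_d.+1 -> 'I_(M + M).+1}) : {poly algC} :=
  \poly_(i < d.+1) ((a (inord i))%:R - M%:R).
pose rts (p : {poly algC}) := sval (closed_field_poly_normal p).
exists (flatten [seq rts (P a) | a : {ffun 'I_d.+1 -> 'I_(M + M).+1}]) => z az Cd leB.
have [rs] := closed_field_poly_normal (minCpoly z).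
rewrite (monicP (minCpoly_monic z)) scale1r => Drs.
pose C := undup rs.
have CP c : reflect (exists nu : aut, nu z = c) (c \in C).
  apply: (iffP idP); rewrite mem_undup -root_prod_XsubC -Drs.
    exact: minCpoly_conj.
  by case=> nu <-; rewrite -(minCpoly_aut nu) root_minCpoly.
have uC : uniq C by apply: undup_uniq.
have szC : (size C <= d)%N by apply: Cd => // c /CP.
pose q := \prod_(c <- C) ('X - c%:P).
have q_aut (nu : aut) : map_poly nu q = q.
  rewrite /q rmorph_prod /=; under eq_bigr => c _ do rewrite map_polyXsubC.
  rewrite -(big_map nu xpredT (fun c => 'X - c%:P)); apply: perm_big.
  have umap : uniq (map nu C) by rewrite map_inj_uniq //; apply: fmorph_inj.
  have sub : {subset map nu C <= C}.
    by move=> _ /mapP[c /CP[mu <-] ->]; apply/CP; exists (nu \o mu).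
  apply: uniq_perm => //; apply: (uniq_min_size umap sub _).2.
  by rewrite size_map.
have q_int i : q`_i \is a Num.int.
  apply: Cint_rat_Aint.
    by apply: aut_fixed_rat => nu; rewrite -coef_map q_aut.
  apply: (polyOverP (_ : q \is a polyOver Aint)).
  rewrite /q big_seq rpred_prod // => c /CP[nu <-].
  by rewrite polyOverXsubC Aint_aut.
have q_le i : `|q`_i| <= M%:R.
  apply: le_trans (_ : (1 + B%:R) ^+ size C <= _).
    by apply: coef_prod_XsubC_norm; rewrite ?ler0n // => c /CP[nu <-].
  by rewrite /M natrX natrD ler_weXn2l // lerDl ler0n.
have szq : size q = (size C).+1 by rewrite size_prod_XsubC.
have q_nat i : {k : 'I_(M + M).+1 | q`_i = k%:R - M%:R}.
  have [k Dk] := sig_eqW (intrP (q_int i)).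
  have lk : (`|k| <= M)%N.
    by rewrite -(ler_nat algC) natr_absz intr_norm -Dk.
  have lt : (`|(k + M%:Z)%R| < (M + M).+1)%N by lia.
  exists (Ordinal lt); rewrite /= Dk natr_absz ger0_norm; last by lia.
  by rewrite rmorphD /= addrK.
pose a := [ffun i : 'I_d.+1 => sval (q_nat i)].
have Pa : P a = q.
  apply/polyP=> i; rewrite coef_poly; case: ltnP => [id|di].
    by rewrite ffunE inordK //; case: (q_nat i).
  by rewrite nth_default // szq; apply: leq_trans di.
apply/flattenP; exists (rts (P a)); first by apply: map_f; rewrite mem_enum.
rewrite Pa /rts; case: closed_field_poly_normal => r /= Dr.
rewrite -root_prod_XsubC -(rootZ _ _ (_ : lead_coef q != 0)) -?Dr.
  rewrite root_prod_XsubC; apply/CP; exists idfun => //.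
by rewrite lead_coef_eq0 -size_poly_eq0 szq.
Qed.

Lemma seq_uniform_bound (T : eqType) (s : seq T) (P : T -> nat -> Prop) :
    (forall x, exists b, forall n, P x n -> (n <= b)%N) ->
  exists b, forall x n, x \in s -> P x n -> (n <= b)%N.
Proof.
move=> bP; elim: s => [|x s [b IH]]; first by exists 0%N.
have [b' b'P] := bP x; exists (maxn b b') => y n.
rewrite inE leq_max => /predU1P[->|sy] Pn; first by rewrite (b'P n Pn) orbT.
by rewrite (IH y n).
Qed.

(** With [D] a denominator of [lam], the number D * y is an algebraic integer of bounded degree and
    bounded conjugates, whatever [l] is, so it takes finitely many values; each value serves a
    single [l]. *)
Theorem root_extraction_bound s (lam : algC) : lam != 0 -> ~ torsion lam ->
  exists B, forall l y zeta, (0 < l)%N -> fixed_by s y -> torsion zeta ->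
    y ^+ l = zeta * lam -> (l <= B)%N.
Proof.
move=> lam0 ntl; have [d dP] := aut_pigeonhole s.
have [D D0 aD] := Aint_denominator lam.
have [rs] := closed_field_poly_normal (minCpoly lam).
rewrite (monicP (minCpoly_monic lam)) scale1r => Drs.
(* The successor makes the bound at least 1, so that it passes from an l-th power to its base. *)
have [B0 B0P] : exists B0 : nat, forall nu : aut, `|nu lam| <= B0.+1%:R.
  pose bnd (x : algC) := Num.Def.archi_bound `|x|.
  exists (\max_(x <- rs) bnd x) => nu; have rsn : nu lam \in rs.
    by rewrite -root_prod_XsubC -Drs -(minCpoly_aut nu) root_minCpoly.
  apply: le_trans (ltW (archi_boundP (normr_ge0 _))) _; rewrite ler_nat.
  exact/leqW/(@leq_bigmax_seq _ rs xpredT bnd _ rsn isT).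
have [Om OmP] := Aint_bounded_finite d (D * B0.+1).
pose P (w : algC) (l : nat) := (0 < l)%N /\
  exists2 zeta, torsion zeta & (w / D%:R) ^+ l = zeta * lam.
have [b bP] : exists b, forall w l, w \in Om -> P w l -> (l <= b)%N.
  apply: seq_uniform_bound => w.
  case: (pselect (exists l, P w l)) => [[l Pl]|none]; last first.
    by exists 0%N => l Pl; case: none; exists l.
  (* Two exponents l < l' for one [w] would make the power l' - l of w / D torsion, hence [lam]
     torsion. *)
  exists l => l' Pl'; apply: contra_notT ntl; rewrite -ltnNge => ll'.
  have [[l0 [z tz e]] [_ [z' tz' e']]] := (Pl, Pl').
  have z0 := torsion_neq0 tz; have z'0 := torsion_neq0 tz'.
  have ty : torsion (w / D%:R).
    apply: (torsion_root (k := (l' - l)%N)); first by rewrite subn_gt0.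
    suff -> : (w / D%:R) ^+ (l' - l) = z' / z by apply: torsion_div.
    apply: (mulIf (_ : (w / D%:R) ^+ l != 0)); first by rewrite e mulf_neq0.
    by rewrite -exprD subnK 1?ltnW // e' e; field.
  have -> : lam = (w / D%:R) ^+ l / z by rewrite e mulrAC divff // mul1r.
  by apply: torsion_div tz; apply: torsionX.
exists b => l y zeta l0 fy tz e; apply: (bP (D%:R * y)); last first.
  split=> //; exists zeta => //.
  by rewrite mulrAC divff ?pnatr_eq0 -?lt0n // mul1r.
apply: OmP.
- apply: (Aint_root l0); rewrite exprMn e -(prednK l0) exprS.
  have -> : D%:R * D%:R ^+ l.-1 * (zeta * lam)
            = (D%:R ^+ l.-1 * zeta) * (D%:R * lam) by ring.
  apply: rpredM aD; apply: rpredM; last exact: torsion_Aint.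
  by apply: rpredX; apply: rpred_nat.
- move=> C uC CP.
  have CP' (i : 'I_(size C)) : exists nu : aut, nu (D%:R * y) = C`_i.
    by apply: CP; rewrite mem_nth.
  have [tau tauP] := choice CP'.
  apply: (dP _ tau) => i j eij; apply/ord_inj/eqP.
  rewrite -(nth_uniq 0 _ _ uC) // -!tauP; apply/eqP.
  rewrite !rmorphM /= !rmorph_nat; congr (_ * _).
  exact: fixed_by_agree fy eij.
move=> nu; rewrite rmorphM rmorph_nat normrM normr_nat natrM ler_wpM2l ?ler0n //.
have e1 : `|nu y| ^+ l = `|nu lam|.
  rewrite -normrX -rmorphXn e rmorphM normrM.
  by rewrite (torsion_norm (torsion_rmorph nu tz)) mul1r.
rewrite real_leNgt ?normr_real ?ger0_real ?ler0n //; apply/negP => lt.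
have : B0.+1%:R < `|nu y| ^+ l.
  apply: (lt_le_trans lt); rewrite ler_eXnr //.
  by apply/ltW/(le_lt_trans _ lt); rewrite ler1n.
by rewrite e1 => /lt_geF; rewrite B0P.
Qed.

(** * Hansel's proof of the Skolem-Mahler-Lech theorem *)

Lemma pigeonhole_nat (T : finType) (g : nat -> T) :
  exists a b, (a < b)%N /\ g a = g b.
Proof.
pose h (i : 'I_#|T|.+1) := g i.
have /injectivePn[i [j ij e]] : ~~ injectiveb h.
  by apply/negP => /injectiveP/leq_card; rewrite card_ord ltnn.
case: (ltngtP i j) => [lt|lt|e']; [by exists i, j|by exists j, i|].
by case/eqP: ij; apply: val_inj.
Qed.

Section PadicIntegrality.
Variable p : nat.
Hypothesis p_pr : prime p.
Implicit Types x y z : algC.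

Let P : algC := p%:R.

Let P0 : P != 0. Proof. by rewrite pnatr_eq0 -lt0n prime_gt0. Qed.

Let Pgt0 : 0 < P. Proof. by rewrite ltr0n prime_gt0. Qed.

(** Divisibility by p^k among all algebraic integers replaces a p-adic valuation, without choosing a
    prime above p or a completion. *)
Definition padic_dvd k : {pred algC} := fun x => x / P ^+ k \in Aint.

Lemma padic_dvdE k x : (x \in padic_dvd k) = (x / P ^+ k \in Aint).
Proof. by []. Qed.

Lemma padic_dvd_le k l x : (k <= l)%N -> x \in padic_dvd l -> x \in padic_dvd k.
Proof.
move=> kl; rewrite !padic_dvdE => xl; rewrite -(subnKC kl) exprD in xl.
have -> : x / P ^+ k = x / (P ^+ k * P ^+ (l - k)) * P ^+ (l - k).
  by field; rewrite !expf_neq0.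
by rewrite rpredM // rpredX // Aint_nat.
Qed.

Lemma padic_dvdD k x y :
  x \in padic_dvd k -> y \in padic_dvd k -> x + y \in padic_dvd k.
Proof. by rewrite !padic_dvdE mulrDl; apply: rpredD. Qed.

Lemma padic_dvd_sum k (I : Type) (r : seq I) (Q : pred I) (F : I -> algC) :
    (forall i, Q i -> F i \in padic_dvd k) ->
  \sum_(i <- r | Q i) F i \in padic_dvd k.
Proof.
by move=> FP; rewrite padic_dvdE mulr_suml; apply: rpred_sum => i /FP.
Qed.

Lemma padic_dvdMl k x y :
  x \in Aint -> y \in padic_dvd k -> x * y \in padic_dvd k.
Proof. by move=> ax; rewrite !padic_dvdE -mulrA; apply: rpredM. Qed.

Lemma padic_dvd_cancel k n x : coprime n p -> x \in Aint ->
  n%:R * x \in padic_dvd k -> x \in padic_dvd k.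
Proof.
move=> co ax nx; have pk0 : (0 < p ^ k)%N by rewrite expn_gt0 prime_gt0.
have {}co : coprime (p ^ k) n by rewrite coprimeXl // coprime_sym.
case: (egcdnP n pk0) => a b e _; rewrite (eqP co) in e.
have e' : a%:R * P ^+ k = b%:R * n%:R + 1 :> algC.
  by rewrite -natrX -!natrM e natrD.
have -> : x = a%:R * P ^+ k * x + (- b%:R) * (n%:R * x).
  by rewrite e'; ring.
apply: padic_dvdD; last first.
  by apply: padic_dvdMl nx; rewrite rpredN; apply: Aint_nat.
rewrite padic_dvdE mulrAC mulfK ?expf_neq0 //.
by apply: rpredM => //; apply: Aint_nat.
Qed.

(** If D / x is integral, so is D / p^k for every k, yet k = D puts this rational strictly between 0
    and 1. *)
Lemma padic_dvd_all_eq0 x : (forall k, x \in padic_dvd k) -> x = 0.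
Proof.
move=> xP; apply/eqP/negPn/negP => x0.
have [D D0 aD] := Aint_denominator x^-1.
have : D%:R / P ^+ D \is a Num.int.
  apply: Cint_rat_Aint.
    by rewrite rpredM ?rpredV ?rpredX ?rpred_nat.
  have -> : D%:R / P ^+ D = D%:R * x^-1 * (x / P ^+ D).
    by field; rewrite x0 expf_neq0.
  exact: rpredM aD (xP D).
have r0 : 0 < D%:R / P ^+ D :> algC.
  by apply: divr_gt0; [rewrite ltr0n | apply: exprn_gt0].
have r1 : D%:R / P ^+ D < 1 :> algC.
  rewrite ltr_pdivrMr ?exprn_gt0 // mul1r -natrX ltr_nat.
  exact/ltn_expl/prime_gt1.
move=> /intrP[m e]; move: r0 r1; rewrite e ltr0z ltrz1; lia.
Qed.

(** Reduced modulo the minimal polynomial and p^2, the powers of [x] take finitely many values, so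
    two coincide; multiplying by a power of [y] cancels the smaller one up to a factor prime to p.
    The square is needed later: p^(2j) / j! keeps a factor p^j. *)
Lemma Aint_power_congr1 x y n : x \in Aint -> y \in Aint ->
    x * y = n%:R -> coprime n p ->
  exists2 N, (0 < N)%N & forall M, (N %| M)%N -> x ^+ M - 1 \in padic_dvd 2.
Proof.
move=> ax ay xy co.
have /floorpP[q Dq] : minCpoly x \is a polyOver Num.int := ax.
have mq : q \is monic.
  have := minCpoly_monic x.
  rewrite !monicE Dq lead_coef_map_inj ?rmorph0 //; last exact: intr_inj.
  by rewrite -(eqr_int algC).
pose r k := Pdiv.CommonRing.rmodp ('X^k) q.
have rx k : (map_poly intr (r k)).[x] = x ^+ k.
  have := congr1 (map_poly (intr : int -> algC)) (Pdiv.RingMonic.rdivp_eq mq 'X^k).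
  rewrite rmorphD rmorphM /= -Dq map_polyXn => /(congr1 (horner^~ x)).
  by rewrite hornerXn hornerD hornerM (rootP (root_minCpoly x)) mulr0 add0r.
have szr k : (size (r k) <= size q)%N.
  by apply/ltnW/Pdiv.CommonRing.ltn_rmodpN0 => //; apply: monic_neq0.
have p2 : (0 < p ^ 2)%N by rewrite expn_gt0 prime_gt0.
pose g k : {ffun 'I_(size q) -> 'I_(p ^ 2).-1.+1} :=
  [ffun j : 'I_(size q) => inord `|((r k)`_j %% (p ^ 2)%N%:Z)%Z|].
have [a [b [ab gab]]] := pigeonhole_nat g.
have rab j : ((r b)`_j = (r a)`_j %[mod (p ^ 2)%N%:Z])%Z.
  case: (ltnP j (size q)) => [jq|qj]; last first.
    by rewrite !nth_default // (leq_trans (szr _)).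
  have := congr1 (fun h : {ffun 'I_(size q) -> 'I_(p ^ 2).-1.+1} =>
    nat_of_ord (h (Ordinal jq))) gab.
  have p2z : (p ^ 2)%N%:Z != 0 by rewrite eqz_nat -lt0n.
  have lt k : (`|((r k)`_j %% (p ^ 2)%N%:Z)%Z| < (p ^ 2).-1.+1)%N.
    rewrite prednK // -ltz_nat gez0_abs ?modz_ge0 // ltz_pmod //.
  rewrite !ffunE !inordK // => e.
  by rewrite -[LHS]gez0_abs ?modz_ge0 // -[RHS]gez0_abs ?modz_ge0 // e.
have dab : x ^+ b - x ^+ a \in padic_dvd 2.
  rewrite -!rx -hornerN -hornerD horner_coef; apply: padic_dvd_sum => j _.
  move: (nat_of_ord j) => {}j; rewrite coefB !coef_map /= mulrC -rmorphB /=.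
  apply: padic_dvdMl; first exact: rpredX.
  have /eqP := rab j; rewrite eqz_mod_dvd => /dvdzP[c ->].
  have p2E : ((p ^ 2)%N%:Z)%:~R = P ^+ 2 by rewrite -natrX.
  rewrite rmorphM /= p2E padic_dvdE mulfK ?expf_neq0 //.
  exact: Aint_int.
exists (b - a)%N; first by rewrite subn_gt0.
move=> _ /dvdnP[m ->]; rewrite mulnC exprM.
set z := x ^+ (b - a).
have zP : z - 1 \in padic_dvd 2.
  have az : z - 1 \in Aint by rewrite rpredB ?rpredX ?rpred1.
  apply: (@padic_dvd_cancel _ (n ^ a)) => //; first exact: coprimeXl.
  have e : x ^+ b = x ^+ a * z by rewrite /z -exprD subnKC // ltnW.
  have -> : (n ^ a)%:R * (z - 1) = y ^+ a * (x ^+ b - x ^+ a).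
    by rewrite natrX -xy exprMn e; ring.
  by apply: padic_dvdMl dab; apply: rpredX.
rewrite subrX1 mulrC; apply: padic_dvdMl zP.
by apply: rpred_sum => i _; rewrite !rpredX.
Qed.

(** * Polynomials with p-adically decaying coefficients *)

Section NewtonPolygon.
Variable delta : nat.

(* Dividing by a linear factor [X - z] raises this bound by one: the roots of
   a polynomial satisfying it force its values to be divisible by [p]. *)
Definition steep (T : nat) (Q : {poly algC}) :=
  forall k, Q`_k \in padic_dvd (k + T - delta).

Lemma steep_horner T Q q : steep T Q -> Q.[q%:R] \in padic_dvd (T - delta).
Proof.
move=> sQ; rewrite horner_coef; apply: padic_dvd_sum => k _.
rewrite mulrC; apply: padic_dvdMl; first by rewrite rpredX ?Aint_nat.
by apply: padic_dvd_le (sQ k); lia.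
Qed.

(** Synthetic division, from the top coefficient down; the shift of index from [Q] to [H] gains the
    power of p. *)
Lemma steep_div_XsubC T (Q H : {poly algC}) (z : nat) :
  Q = H * ('X - z%:R%:P) -> steep T Q -> steep T.+1 H.
Proof.
move=> DQ sQ k.
have HE j : H`_j = Q`_j.+1 + z%:R * H`_j.+1.
  by rewrite DQ mulrBr coefB coefMX coefMC /=; ring.
have [m] := ubnP (size H - k); elim: m k => // m IH k lem.
case: (ltnP k (size H)) => [kH|Hk]; last first.
  by rewrite nth_default // padic_dvdE mul0r rpred0.
rewrite HE; apply: padic_dvdD.
  by have := sQ k.+1; rewrite addSnnS.
apply: padic_dvdMl; first by rewrite Aint_nat.
by apply: padic_dvd_le (IH k.+1 _); lia.
Qed.

Lemma steep_roots T (Q : {poly algC}) (zs : seq nat) (q : nat) :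
    uniq zs -> (forall z : nat, z \in zs -> Q.[z%:R] = 0) -> steep T Q ->
  Q.[q%:R] \in padic_dvd (T + size zs - delta).
Proof.
elim: zs T Q => [|z zs IH] T Q /=.
  by move=> _ _ sQ; rewrite addn0; apply: steep_horner.
case/andP=> zzs uzs Q0 sQ.
have /factor_theorem[H DQ] : root Q z%:R by apply/rootP/Q0/mem_head.
have sH := steep_div_XsubC DQ sQ.
rewrite DQ hornerM hornerXsubC mulrC; apply: padic_dvdMl.
  by rewrite rpredB // Aint_nat.
rewrite addnS -addSn; apply: IH => // w wzs.
have /eqP := Q0 w (mem_behead (s := z :: zs) wzs).
rewrite DQ hornerM hornerXsubC mulf_eq0 subr_eq0 eqr_nat => /orP[/eqP//|/eqP wz].
by rewrite -wz wzs in zzs.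
Qed.

Lemma logn_fact_le j : (logn p j`! <= j)%N.
Proof.
rewrite logn_fact //.
have le m : (\sum_(1 <= k < m.+1) j %/ p ^ k + j %/ p ^ m <= j)%N.
  elim: m => [|m IH]; first by rewrite big_geq // expn0 divn1.
  rewrite big_nat_recr //=; apply: leq_trans IH; rewrite -addnA leq_add2l.
  rewrite addnn -mul2n expnSr divnMA.
  apply: leq_trans (leq_divM (j %/ p ^ m) p); rewrite mulnC leq_mul2l.
  by rewrite prime_gt1 ?orbT.
by apply: leq_trans (le j); apply: leq_addr.
Qed.

(** The prime-to-p part of j! divides that of J!, and its p-part is at most p^j. The quotient is the
    coefficient used in [binomial_truncation]. *)
Lemma fact_dvd_p'part J j : (j <= J)%N -> (j`! * p ^ j %| (J`!)`_p^' * p ^ (2 * j))%N.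
Proof.
move=> jJ; rewrite mul2n -addnn expnD mulnA dvdn_mul //.
rewrite -[j`!](partnC p (fact_gt0 j)) mulnC dvdn_mul //.
  by rewrite partn_dvd ?fact_gt0 // -(bin_fact jJ) mulnCA dvdn_mulr.
by rewrite p_part dvdn_exp2l // logn_fact_le.
Qed.

Definition falling (j : nat) : {poly algC} := \prod_(0 <= l < j) ('X - (l%:R)%:P).

Lemma falling_horner j q : (falling j).[q%:R] = (q ^_ j)%:R.
Proof.
elim: j => [|j IH]; first by rewrite /falling big_geq // hornerC ffactn0.
rewrite /falling big_nat_recr //= hornerM hornerXsubC -/(falling j) IH ffactnSr.
case: (leqP j q) => jq; first by rewrite natrM natrB.
by rewrite ffact_small // mul0n mul0r.
Qed.

Lemma falling_Aint j : falling j \is a polyOver Aint.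
Proof. by apply: rpred_prod => i _; rewrite polyOverXsubC; apply: Aint_nat. Qed.

(* [J]`!_p^' times the truncation at order [J] of the binomial series of
   [(1 + p^2 eta)^X], as a polynomial in [X]. *)
Definition binomial_truncation (eta : algC) J : {poly algC} :=
  \sum_(j < J.+1) (((J`!)`_p^' * p ^ (2 * j) %/ (j`! * p ^ j))%:R * P ^+ j
                    * eta ^+ j) *: falling j.

Lemma binomial_truncation_horner eta J q : (q <= J)%N ->
  (binomial_truncation eta J).[q%:R] = ((J`!)`_p^')%:R * (1 + P ^+ 2 * eta) ^+ q.
Proof.
move=> qJ; rewrite horner_sum exprDn mulr_sumr.
rewrite [RHS](big_ord_widen J.+1 (fun j => ((J`!)`_p^')%:R *
  (1 ^+ (q - j) * (P ^+ 2 * eta) ^+ j *+ 'C(q, j)))) //.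
rewrite [RHS]big_mkcond /=; apply: eq_bigr => j _.
rewrite hornerZ falling_horner; case: ltnP => [jq|qj]; last first.
  by rewrite ffact_small ?mulr0.
rewrite expr1n mul1r exprMn -bin_ffact.
have jJ : (j <= J)%N by rewrite -ltnS.
have := divnK (fact_dvd_p'part jJ); set e := (_ %/ _)%N => De.
have De' : e%:R * (j`!%:R * P ^+ j) = ((J`!)`_p^')%:R * P ^+ (2 * j) :> algC.
  by rewrite /P -!natrX -!natrM De.
rewrite -mulr_natl natrM -exprM.
transitivity (e%:R * (j`!%:R * P ^+ j) * eta ^+ j * 'C(q, j)%:R); first by ring.
by rewrite De'; ring.
Qed.

(** [falling j] has degree [j], so a coefficient of index k - l involves only j >= k - l and carries
    that power of p; multiplying by [F] costs at most l <= [delta]. *)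
Lemma steep_binomial_truncation eta J (F : {poly algC}) : eta \in Aint ->
    F \is a polyOver Aint -> (size F <= delta.+1)%N ->
  steep 0 (F * binomial_truncation eta J).
Proof.
move=> aeta aF szF k; rewrite coefM; apply: padic_dvd_sum => -[l /= lk] _.
case: (ltnP delta l) => [dl|ld].
  by rewrite nth_default ?mul0r ?padic_dvdE ?mul0r ?rpred0 // (leq_trans szF).
apply: padic_dvdMl; first exact: (polyOverP aF).
apply: (@padic_dvd_le _ (k - l)); first by lia.
rewrite coef_sum; apply: padic_dvd_sum => j _; rewrite coefZ.
case: (ltnP j (k - l)) => [jk|kj].
  by rewrite nth_default ?mulr0 ?padic_dvdE ?mul0r ?rpred0 // /falling
       size_prod_XsubC size_iota subn0.
rewrite mulrAC mulrC; apply: (padic_dvd_le kj).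
rewrite mulrC mulrAC [_ * P ^+ j]mulrC -!mulrA mulrC; apply: padic_dvdMl.
  rewrite rpredM ?Aint_nat // rpredM //; first exact: rpredX.
  exact: (polyOverP (falling_Aint j)).
by rewrite padic_dvdE divff ?expf_neq0 // rpred1.
Qed.

End NewtonPolygon.

Lemma binomial_exp_sum_eq0 (I : finType) (A : {set I}) (F : I -> {poly algC})
    (eta : I -> algC) :
    {in A, forall i, eta i \in Aint} -> {in A, forall i, F i \is a polyOver Aint} ->
    (forall m, exists2 q, (m <= q)%N &
       \sum_(i in A) (F i).[q%:R] * (1 + P ^+ 2 * eta i) ^+ q = 0) ->
  forall q : nat, \sum_(i in A) (F i).[q%:R] * (1 + P ^+ 2 * eta i) ^+ q = 0.
Proof.
move=> aeta aF inf0 q.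
pose w (q : nat) := \sum_(i in A) (F i).[q%:R] * (1 + P ^+ 2 * eta i) ^+ q.
have {}inf0 m : exists2 q, (m <= q)%N & w q = 0 := inf0 m.
rewrite -/(w q).
pose delta := \max_(i in A) size (F i).
have szF i : i \in A -> (size (F i) <= delta.+1)%N.
  by move=> Ai; apply: leqW; apply: (bigop.bigmax_sup i).
have zeros T : exists zs : seq nat,
    [/\ uniq zs, size zs = T & forall z : nat, z \in zs -> w z = 0].
  elim: T => [|T [zs [us <- zsP]]]; first by exists [::].
  have [z lez z0] := inf0 (\max_(i <- zs) i).+1.
  exists (z :: zs); split=> //=; last by move=> i;
    rewrite inE => /predU1P[->|/zsP].
  rewrite us andbT; apply/negP => zin.
  by have := @leq_bigmax_seq _ zs xpredT id z zin isT; rewrite leqNgt lez.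
apply: padic_dvd_all_eq0 => T.
(* The [delta] extra zeros pay for the loss in [steep], so [Q] at [q] is divisible by p^T. [J]
   exceeds [q] and all chosen zeros, where the truncation is exact; its scaling factor is prime to p
   and cancels. *)
have [zs [us szs zsP]] := zeros (T + delta)%N.
pose J := maxn q (\max_(i <- zs) i).
pose Q := \sum_(i in A) F i * binomial_truncation (eta i) J.
have QE (z : nat) : (z <= J)%N -> Q.[z%:R] = ((J`!)`_p^')%:R * w z.
  move=> zJ; rewrite horner_sum mulr_sumr; apply: eq_bigr => i _.
  by rewrite hornerM binomial_truncation_horner //; ring.
have sQ : steep delta 0 Q.
  move=> k; rewrite coef_sum; apply: padic_dvd_sum => i Ai.
  by apply: steep_binomial_truncation; rewrite ?aeta ?aF ?szF.
have Aw : w q \in Aint.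
  rewrite rpred_sum // => i Ai; rewrite rpredM //.
    by apply: rpred_horner; [apply: aF | apply: Aint_nat].
  by rewrite rpredX // rpredD ?rpred1 // rpredM ?aeta // rpredX // Aint_nat.
apply: (@padic_dvd_cancel _ ((J`!)`_p^')) => //.
  by rewrite coprime_sym; apply: pnat_coprime (pnat_id p_pr) (part_pnat _ _).
rewrite -QE ?leq_maxl //.
have -> : T = (0 + size zs - delta)%N by rewrite szs add0n addnK.
apply: steep_roots sQ => // z zzs; rewrite QE ?zsP ?mulr0 // leq_max.
by rewrite (@leq_bigmax_seq _ zs xpredT id z zzs isT) orbT.
Qed.

End PadicIntegrality.

Lemma Aint_seq_denominator (s : seq algC) :
  exists2 D, (0 < D)%N & forall x, x \in s -> D%:R * x \in Aint.
Proof.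
elim: s => [|x s [D D0 aD]]; first by exists 1%N.
have [D' D'0 aD'] := Aint_denominator x.
exists (D * D')%N => [|y]; first by rewrite muln_gt0 D0.
rewrite inE natrM => /predU1P[->|sy].
  by rewrite -mulrA; apply: rpredM aD'; apply: Aint_nat.
by rewrite mulrAC; apply: rpredM; [apply: aD | apply: Aint_nat].
Qed.

Section SkolemMahlerLech.
Variables (I : finType) (A : {set I}) (lam : I -> algC) (f : I -> {poly algC}).
Hypotheses (lam0 : {in A, forall i, lam i != 0})
  (nondeg : {in A &, forall i j, i != j -> ~ torsion (lam i / lam j)}).

Let charC0 : [pchar algC] =i pred0 := pchar_num _.

Lemma exp_sum_progression_eq0 N r : (0 < N)%N ->
    (forall q : nat,
       \sum_(i in A) (f i).[(r + N * q)%:R] * lam i ^+ (r + N * q) = 0) ->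
  {in A, forall i, f i = 0}.
Proof.
move=> N0 sum0 i Ai.
pose g i := lam i ^+ r *: (f i \Po (r%:R%:P + N%:R *: 'X)).
have g0 : {in A, forall i, g i = 0}.
  apply: (exp_poly_eq0 charC0 (lam := fun i => lam i ^+ N)).
  - move=> j k Aj Ak /= e; apply/eqP/negPn/negP => jk.
    case: (nondeg Aj Ak jk); exists N => //.
    by rewrite expr_div_n e divff // expf_neq0 ?lam0.
  - by move=> j Aj; rewrite expf_neq0 ?lam0.
  move=> n; rewrite -[RHS](sum0 n); apply: eq_bigr => j _.
  rewrite hornerZ horner_comp hornerD hornerC hornerZ hornerX.
  by rewrite exprD exprM natrD natrM; ring.
have /eqP := g0 i Ai; rewrite scaler_eq0 expf_eq0 (negPf (lam0 Ai)) andbF /=.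
have sz2 : size (r%:R%:P + N%:R *: 'X : {poly algC}) = 2%N.
  rewrite addrC size_polyDl size_scale ?pnatr_eq0 -?lt0n // size_polyX //.
  by rewrite ltnS size_polyC leq_b1.
by rewrite -size_poly_eq0 size_comp_poly2 // size_poly_eq0 => /eqP.
Qed.

Lemma exp_sum_zeros_nat : (0 < #|A|)%N -> {in A, forall i, f i != 0} ->
  exists B, forall n : nat,
    \sum_(i in A) (f i).[n%:R] * lam i ^+ n = 0 -> (n <= B)%N.
Proof.
move=> /card_gt0P[i0 Ai0] f0; apply: contrapT => unb.
have [D D0 aD] := Aint_seq_denominator
  ([seq lam i | i in A] ++ [seq (lam i)^-1 | i in A]).
pose x i := D%:R * lam i; pose y i := D%:R * (lam i)^-1.
have ax i : i \in A -> x i \in Aint.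
  by move=> Ai; apply: aD; rewrite mem_cat map_f ?mem_enum.
have ay i : i \in A -> y i \in Aint.
  by move=> Ai; apply: aD;
    rewrite mem_cat orbC (map_f (fun i => (lam i)^-1)) ?mem_enum.
have xy i : i \in A -> x i * y i = (D ^ 2)%:R.
  by move=> Ai; rewrite natrX /x /y; field; apply: lam0.
(* Since x * y = D^2 is prime to p, each [x i] is invertible modulo p and some power of it is 1
   modulo p^2. *)
have [p Dp p_pr] := prime_above (D ^ 2).
have co : coprime (D ^ 2) p.
  by rewrite coprime_sym prime_coprime // gtnNdvd // expn_gt0 D0.
have ex_N i : exists N, (0 < N)%N /\ (i \in A ->
    forall M, (N %| M)%N -> x i ^+ M - 1 \in padic_dvd p 2).
  case: (boolP (i \in A)) => Ai; last by exists 1%N.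
  by have [N] := Aint_power_congr1 p_pr (ax i Ai) (ay i Ai) (xy i Ai) co;
    exists N.
have [N_ N_P] := choice ex_N; pose N := (\prod_i N_ i)%N.
have N0 : (0 < N)%N by apply: prodn_gt0 => i; case: (N_P i).
pose eta i := (x i ^+ N - 1) / p%:R ^+ 2.
have aeta : {in A, forall i, eta i \in Aint}.
  move=> i Ai; apply: (N_P i).2 => //.
  by rewrite /N (bigD1 i) //= dvdn_mulr.
have etaE i : 1 + p%:R ^+ 2 * eta i = x i ^+ N.
  by rewrite /eta; field; rewrite pnatr_eq0 -lt0n prime_gt0.
pose zero n := \sum_(i in A) (f i).[n%:R] * lam i ^+ n = 0.
(* Unboundedly many zeros put unboundedly many into one residue class modulo [N], on which the sum
   becomes one in powers of 1 + p^2 * eta. *)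
have [r infr] : exists r, forall m, exists2 q, (m <= q)%N & zero (r + N * q)%N.
  apply: contrapT => none; apply: unb.
  have [|b bP] := @seq_uniform_bound _ (iota 0 N) (fun r q => zero (r + N * q)%N).
    move=> r; apply: contrapT => unb; apply: none; exists r => m.
    apply: contrapT => nom; apply: unb; exists m => q z.
    by rewrite leqNgt; apply/negP => mq; apply: nom; exists q => //;
      apply: ltnW.
  exists (N * b.+1)%N => n zn; rewrite (divn_eq n N) addnC.
  have rN : (n %% N < N)%N by rewrite ltn_mod.
  have qb : (n %/ N <= b)%N.
    by apply: (bP (n %% N)%N); rewrite ?mem_iota //= mulnC addnC -divn_eq.
  by rewrite mulnS; apply: leq_add (ltnW rN) _; rewrite [(_ * N)%N]mulnC;
    apply: leq_mul.
pose g i := x i ^+ r *: (f i \Po (r%:R%:P + N%:R *: 'X)).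
have [c c0 ac] := Aint_seq_denominator (flatten [seq (g i : seq algC) | i in A]).
pose F i := c%:R *: g i.
have aF : {in A, forall i, F i \is a polyOver Aint}.
  move=> i Ai; apply/polyOverP => k; rewrite coefZ.
  case: (ltnP k (size (g i))) => [kg|gk];
    last by rewrite nth_default // mulr0 rpred0.
  apply: ac; apply/flattenP; exists (g i : seq algC); last exact: mem_nth.
  by apply: map_f; rewrite mem_enum.
have FE q : \sum_(i in A) (F i).[q%:R] * (1 + p%:R ^+ 2 * eta i) ^+ q
    = c%:R * D%:R ^+ (r + N * q) *
      \sum_(i in A) (f i).[(r + N * q)%:R] * lam i ^+ (r + N * q).
  rewrite mulr_sumr; apply: eq_bigr => i _; rewrite etaE /F /g !hornerZ.
  rewrite horner_comp hornerD hornerC hornerZ hornerX /x.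
  by rewrite -natrM -natrD !exprMn !exprD !exprM; ring.
have cD0 q : c%:R * D%:R ^+ (r + N * q) != 0 :> algC.
  by rewrite mulf_neq0 ?expf_neq0 // pnatr_eq0 -lt0n.
suff all0 q : zero (r + N * q)%N.
  by have /eqP := exp_sum_progression_eq0 N0 all0 Ai0; apply/negP/f0.
apply/eqP; rewrite -(inj_eq (mulfI (cD0 q))) mulr0 -FE; apply/eqP.
apply: (binomial_exp_sum_eq0 p_pr aeta aF) => m.
by have [q' mq zq] := infr m; exists q' => //; rewrite FE zq mulr0.
Qed.

End SkolemMahlerLech.

Theorem skolem_mahler_lech (I : finType) (A : {set I}) (lam : I -> algC)
    (f : I -> {poly algC}) :
    (0 < #|A|)%N -> {in A, forall i, lam i != 0} ->
    {in A &, forall i j, i != j -> ~ torsion (lam i / lam j)} ->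
    {in A, forall i, f i != 0} ->
  exists B, forall k : int,
    \sum_(i in A) (f i).[k%:~R] * lam i ^ k = 0 -> (`|k| <= B)%N.
Proof.
move=> A0 lam0 nondeg f0; have [B BP] := exp_sum_zeros_nat lam0 nondeg A0 f0.
have lam0' : {in A, forall i, (lam i)^-1 != 0}.
  by move=> i Ai; rewrite invr_eq0 lam0.
have nondeg' : {in A &, forall i j, i != j -> ~ torsion ((lam i)^-1 / (lam j)^-1)}.
  by move=> i j Ai Aj ij; rewrite invrK mulrC; apply: nondeg; rewrite // eq_sym.
have f0' : {in A, forall i, f i \Po (- 'X) != 0}.
  move=> i Ai; rewrite -size_poly_eq0 size_comp_poly2 ?size_polyN ?size_polyX //.
  by rewrite size_poly_eq0 f0.
have [B' B'P] := exp_sum_zeros_nat lam0' nondeg' A0 f0'.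
exists (maxn B B') => k; rewrite leq_max; case: (intP k) => [|n|n] sum0.
- by [].
- by rewrite BP.
rewrite abszN; apply/orP; right; apply: B'P; rewrite -[RHS]sum0.
apply: eq_bigr => i _; rewrite horner_comp hornerN hornerX.
by rewrite exprVn rmorphN /= -exprnN.
Qed.

(** * Twisted rational zeros over the algebraic numbers *)

Lemma torsion_exprz (R : fieldType) (x : R) (k : int) : torsion x -> torsion (x ^ k).
Proof.
by case: (intP k) => [|n|n] tx; rewrite -?exprnN -?exprnP;
  try apply: torsionV; apply: torsionX.
Qed.

Lemma fixed_by_exprz s x (k : int) : fixed_by s x -> fixed_by s (x ^ k).
Proof. by move=> fx nu f; rewrite fmorphXz /= fx. Qed.

Lemma expr_expz_swap (R : fieldType) (x : R) (n : nat) (k : int) :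
  (x ^ k) ^+ n = (x ^+ n) ^ k.
Proof. by rewrite !exprnP !exprz_exp mulrC. Qed.

Lemma uniform_bound_fin (T : finType) (P : T -> nat -> Prop) :
    (forall x, exists b, forall n, P x n -> (n <= b)%N) ->
  exists b, forall x n, P x n -> (n <= b)%N.
Proof.
move=> bP; have [b bE] := @seq_uniform_bound _ (enum T) P bP.
by exists b => x n; apply: bE; rewrite mem_enum.
Qed.

Lemma card_gt0_singleton_or_pair (T : finType) (A : {set T}) : (0 < #|A|)%N ->
  (exists i, A = [set i]) \/ exists i j, [/\ i \in A, j \in A & i != j].
Proof.
rewrite leq_eqVlt => /predU1P[/esym/eqP/cards1P[i ->]|/card_gt1P[i [j [Ai Aj ij]]]].
  by left; exists i.
by right; exists i, j.
Qed.

(** Merges a determination of lam^a and its root of unity into one number. *)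
Definition twisted_power (R : fieldType) (lam : R) (a : rat) (x : R) :=
  torsion (x ^+ `|denq a| / lam ^ numq a).

Lemma twisted_power_neq0 (R : fieldType) (lam : R) a x :
  twisted_power lam a x -> x != 0.
Proof.
move=> tx; apply/eqP => x0; have := torsion_neq0 tx.
by rewrite x0 expr0n absz_eq0 denq_eq0 mul0r eqxx.
Qed.

Lemma absz_denq_gt0 a : (0 < `|denq a|)%N.
Proof. by rewrite absz_gt0 denq_neq0. Qed.

(** Up to roots of unity x^l = lam^k with k and l coprime. Bezout u * k + v * l = 1 makes x^(N u)
    lam^(N v) an l-th root of lam^N. *)
Lemma twisted_power_root_extraction s (lam x zeta : algC) a N :
    lam != 0 -> x != 0 -> torsion zeta -> torsion (x ^+ `|denq a| / lam ^ numq a) ->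
    fixed_by s lam -> fixed_by s (zeta * x ^+ N) ->
  exists z eta, [/\ fixed_by s z, torsion eta
    & z ^+ `|denq a| = eta * lam ^+ N].
Proof.
move=> lam0 x0 tz tx flam fx; set l := `|denq a|%N in tx *;
  set k := numq a in tx *.
have [u [v uv]] : exists u v : int, u * k + v * l%:Z = 1.
  have /eqP co : coprimez k l by rewrite coprimezE coprime_num_den.
  have [u [v uv]] := Bezoutz k l.
  by exists u, v; rewrite uv.
exists ((zeta * x ^+ N) ^ u * (lam ^+ N) ^ v).
exists ((zeta ^+ l * (x ^+ l / lam ^ k) ^+ N) ^ u); split.
- by apply: fixed_byM; apply: fixed_by_exprz => //; apply: fixed_byX.
- by apply: torsion_exprz; apply: torsionM; apply: torsionX.
rewrite exprMn !expr_expz_swap exprMn.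
have -> : (lam ^+ N ^+ l) ^ v = (lam ^+ N) ^ (v * l%:Z).
  by rewrite exprnP exprz_exp mulrC.
have -> : x ^+ N ^+ l = (x ^+ l / lam ^ k) ^+ N * (lam ^+ N) ^ k.
  rewrite expr_div_n -expr_expz_swap divfK ?expf_neq0 ?expfz_neq0 //.
  by rewrite exprAC.
rewrite mulrA expfzMl exprz_exp -mulrA -expfzDr ?expf_neq0 //.
by rewrite [k * u]mulrC uv expr1z.
Qed.

Section TwistedZeros.
Variables (I : finType) (lam : I -> algC) (f : I -> {poly algC}).
Hypotheses (lam0 : forall i, lam i != 0)
  (nondeg : forall i j, i != j -> ~ torsion (lam i / lam j))
  (f0 : forall i, f i != 0).

Let coefs : seq algC := flatten [seq (f i : seq algC) | i : I].

Let fixed_value s i a : {subset coefs <= s} -> fixed_by s (f i).[ratr a].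
Proof.
move=> cs; apply: fixed_by_horner => [k|]; last exact: fixed_by_rat.
case: (ltnP k (size (f i))) => [kf|fk]; last first.
  by rewrite nth_default // => nu _; rewrite rmorph0.
apply/fixed_by_mem/cs/flattenP; exists (f i : seq algC); last exact: mem_nth.
by apply: map_f; rewrite mem_enum.
Qed.

Lemma minrel_denominator_bound : exists B, forall a (A : {set I}) x,
    (forall i, twisted_power (lam i) a (x i)) ->
    minrel (fun i => (f i).[ratr a] * x i) A -> (1 < #|A|)%N ->
  (`|denq a| <= B)%N.
Proof.
pose s := [seq lam i | i : I] ++ coefs.
have lam_s i : fixed_by s (lam i).
  by apply: fixed_by_mem; rewrite mem_cat map_f ?mem_enum.
have [N N0 NP] := minrel_fixed_power s I.
have [|B BP] := @uniform_bound_fin (I * I)%type (fun ij l => [/\ ij.1 != ij.2,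
    (0 < l)%N & exists z eta, [/\ fixed_by s z, torsion eta
    & z ^+ l = eta * (lam ij.1 / lam ij.2) ^+ N]]).
  move=> [i j] /=; case: (boolP (i == j)) => ij; first by exists 0%N => n [].
  have [||B BP] := @root_extraction_bound s ((lam i / lam j) ^+ N).
  - by rewrite expf_neq0 // mulf_neq0 ?invr_eq0.
  - by move/(torsion_root N0); apply: nondeg.
  by exists B => n [_ n0 [z [eta [fz te e]]]]; apply: BP te e.
exists B => a A x tx minA /card_gt1P[i [j [Ai Aj ij]]].
have x0 i' : x i' != 0 by apply: twisted_power_neq0 (tx i').
set l := `|denq a|%N.
have [r r0 xr] := common_torsion_exponent tx.
have [zeta tz fz] : exists2 zeta, torsion zeta
    & fixed_by s (zeta * (x i / x j) ^+ N).
  apply: (NP A (fun i => (f i).[ratr a]) x (l * r)%N) => //.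
  - by rewrite muln_gt0 absz_denq_gt0.
  - by move=> k _; apply: fixed_value => c cc; rewrite mem_cat cc orbT.
  move=> k _; have -> : x k ^+ (l * r) = (lam k ^ numq a) ^+ r.
    by rewrite exprM -[in LHS](divfK (expfz_neq0 (numq a) (lam0 k)) (x k ^+ l))
               exprMn xr mul1r.
  by apply: fixed_byX; apply: fixed_by_exprz.
apply: (BP (i, j)); split=> //=; first exact: absz_denq_gt0.
apply: (@twisted_power_root_extraction s (lam i / lam j) (x i / x j) zeta) => //.
- by rewrite mulf_neq0 ?invr_eq0.
- by rewrite mulf_neq0 ?invr_eq0.
- have -> : (x i / x j) ^+ l / (lam i / lam j) ^ numq a
            = (x i ^+ l / lam i ^ numq a) / (x j ^+ l / lam j ^ numq a).
    rewrite expr_div_n expfzMl exprz_inv -invr_expz; field.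
    by rewrite !expfz_neq0 ?expf_neq0.
  exact: torsion_div (tx i) (tx j).
by apply: fixed_byM => //; apply: fixed_byV.
Qed.

Theorem algC_twisted_zeros : (0 < #|I|)%N -> exists S : seq rat, forall a x,
    (forall i, twisted_power (lam i) a (x i)) ->
    \sum_i (f i).[ratr a] * x i = 0 ->
  a \in S.
Proof.
move=> I0; have [B BP] := minrel_denominator_bound.
(* [D] is a multiple of every denominator up to [B]; with D-th roots [mu] of [lam], the twisted
   powers for a = k/D become roots of unity times integer powers mu^k. *)
pose D := B`!; have D0 : (0 < D)%N by apply: fact_gt0.
pose mu i := D.-root (lam i).
have muD i : mu i ^+ D = lam i by apply: rootCK.
have mu0 i : mu i != 0.
  by apply/eqP => z; move/eqP: (lam0 i); rewrite -muD z expr0n (gtn_eqF D0).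
pose s := [seq mu i | i : I] ++ coefs.
have mu_s i : fixed_by s (mu i).
  by apply: fixed_by_mem; rewrite mem_cat map_f ?mem_enum.
have [N N0 NP] := mann_bound s I.
have [w wP] := C_prim_root_exists N0.
pose g i : {poly algC} := f i \Po (D%:R^-1 *: 'X).
have g0 i : g i != 0.
  rewrite -size_poly_eq0 size_comp_poly2; first by rewrite size_poly_eq0.
  by rewrite size_scale ?size_polyX // invr_eq0 pnatr_eq0 -lt0n.
have gE i (k : int) : (g i).[k%:~R] = (f i).[ratr (k%:~R / D%:R)].
  rewrite horner_comp hornerZ hornerX fmorph_div /= ratr_int ratr_nat.
  by rewrite mulrC.
have w0 : w != 0 by apply: torsion_neq0; exists N;
  rewrite ?(prim_expr_order wP).
(* By [mann_bound] the twists of a minimal relation are, up to a common factor, powers of [w]. Hence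
   finitely many pairs (support, exponents), each a recurrence with finitely many zeros. *)
have [|K KP] := @uniform_bound_fin ({set I} * {ffun I -> 'I_N})%type
  (fun Ae n => (0 < #|Ae.1|)%N /\ exists2 k : int, n = `|k|%N &
    \sum_(i in Ae.1) (w ^+ (Ae.2 i : nat) *: g i).[k%:~R] * mu i ^ k = 0).
  move=> [A e] /=; case: (posnP #|A|) => A0; first by exists 0%N => n [].
  have [|i j _ _ ij|i _|b bP] := @skolem_mahler_lech I A mu
    (fun i => w ^+ (e i : nat) *: g i) A0.
  - by move=> i _; apply: mu0.
  - move=> /(torsionX D); rewrite expr_div_n !muD; exact: nondeg.
  - by rewrite scaler_eq0 expf_eq0 (negPf w0) andbF g0.
  by exists b => n [_ [k -> /bP]].
pose S1 : seq rat := [seq (n%:Z - K%:Z)%:~R / D%:R | n <- iota 0 (K + K).+1].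
(* One-term relations force f_i(a) = 0. The value of [getCrat] at an irrational root merely
   lengthens the list. *)
pose rat_roots i : seq rat :=
  [seq getCrat z | z <- sval (closed_field_poly_normal (f i))].
pose S2 : seq rat := flatten [seq rat_roots i | i : I].
exists (S1 ++ S2) => a x tx sum0; rewrite mem_cat.
have x0 i : x i != 0 by apply: twisted_power_neq0 (tx i).
have [||A minA _] := @minrel_exists _ _ (fun i => (f i).[ratr a] * x i) [set: I] _ _.
- by rewrite cardsT.
- by rewrite -[RHS]sum0; apply: eq_bigl => i; rewrite inE.
have A0 : (0 < #|A|)%N by case/minsetp/andP: minA.
have [[i Di]|[i [j [Ai Aj ij]]]] := card_gt0_singleton_or_pair A0.
  apply/orP; right; have := minrel_sum minA; rewrite Di big_set1 => /eqP.
  rewrite mulf_eq0 (negPf (x0 i)) orbF => /eqP fa.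
  apply/flattenP; exists (rat_roots i); first by rewrite map_f ?mem_enum.
  apply/mapP; exists (ratr a); last by rewrite -[LHS]ratCK.
  case: closed_field_poly_normal => r /= Dr; rewrite -root_prod_XsubC.
  by rewrite -(rootZ _ _ (_ : lead_coef (f i) != 0)) -?Dr ?lead_coef_eq0 //;
    apply/rootP.
apply/orP; left; set l := `|denq a|%N.
have lB : (l <= B)%N.
  by apply: BP tx minA _; apply/card_gt1P; exists i, j.
have /dvdnP[e De] : (l %| D)%N by rewrite dvdn_fact // absz_denq_gt0.
pose k : int := numq a * e%:Z.
have aE : a = k%:~R / D%:R.
  rewrite De /k rmorphM natrM /= -{1}[a]divq_num_den -absz_denq -/l.
  field; rewrite !pnatr_eq0 -!lt0n absz_denq_gt0.
  by rewrite -(ltn_pmul2r (absz_denq_gt0 a)) mul0n -De.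
pose xi i := x i / mu i ^ k.
have txi h : torsion (xi h).
  apply: (torsion_root (absz_denq_gt0 a)); rewrite /xi expr_div_n.
  suff -> : (mu h ^ k) ^+ `|denq a| = lam h ^ numq a by apply: tx.
  by rewrite -muD De exprnP !exprz_exp exprnP exprz_exp; congr (_ ^ _);
    rewrite /k; lia.
have [m m0 xim] := common_torsion_exponent txi.
pose c h := (f h).[ratr a] * mu h ^ k.
have cxi : (fun h => (f h).[ratr a] * x h) = (fun h => c h * xi h).
  by apply/funext => h; rewrite /c /xi; field; rewrite expfz_neq0.
rewrite cxi in minA.
have xiN h : h \in A -> (xi h / xi i) ^+ N = 1.
  move=> Ah; apply: (NP A c xi m) => // h' _; apply: fixed_byM.
    by apply: fixed_value => z zc; rewrite mem_cat zc orbT.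
  exact: fixed_by_exprz.
have ex_e h : exists eh : 'I_N, h \in A -> xi h = xi i * w ^+ eh.
  case: (boolP (h \in A)) => Ah; last by exists (Ordinal N0).
  have /(prim_rootP wP)[eh e_h] := xiN h Ah; exists eh => _.
  by rewrite -e_h mulrC divfK // (torsion_neq0 (txi i)).
have [ee eeP] := choice ex_e.
have kK : (`|k| <= K)%N.
  apply: (KP (A, [ffun h => ee h])); split=> //; exists k => //=.
  apply: (mulfI (torsion_neq0 (txi i))); rewrite mulr0 mulr_sumr.
  rewrite -[RHS](minrel_sum minA); apply: eq_bigr => h Ah.
  by rewrite ffunE hornerZ gE -aE (eeP h Ah) /c; ring.
apply/mapP; exists `|(k + K%:Z)%R|%N; first by rewrite mem_iota; lia.
by rewrite aE; congr (_%:~R / _); lia.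
Qed.

End TwistedZeros.

(** * Specialization to the algebraic numbers *)

Lemma resultant_map (R R' : nzRingType) (g : {rmorphism R -> R'}) (p q : {poly R}) :
    g (lead_coef p) != 0 -> g (lead_coef q) != 0 ->
  g (resultant p q) = resultant (map_poly g p) (map_poly g q).
Proof.
move=> nz_gp nz_gq; rewrite /resultant /Sylvester_mx !size_map_poly_id0 //.
rewrite -det_map_mx /= map_col_mx; congr (\det (col_mx _ _));
  by apply: map_lin1_mx => v; rewrite map_poly_rV rmorphM /= map_rVpoly.
Qed.

Lemma resultant_closed (R : comNzRingType) (S : subringClosed R) (p q : {poly R}) :
  p \is a polyOver S -> q \is a polyOver S -> resultant p q \in S.
Proof.
move=> Sp Sq; rewrite /resultant /determinant; apply: rpred_sum => s _.
apply: rpredM; first by rewrite rpredX // rpredN rpred1.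
apply: rpred_prod => i _; rewrite Sylvester_mxE.
by case: split => j; apply: rpredMn; apply: polyOverP.
Qed.

(* Partial ring homomorphisms from [L] to [algC] are represented by their
   graphs, which are subrings of the product ring [L * algC]. *)
Section PartialMorphisms.
Variable L : closedFieldType.
Hypothesis charL0 : [pchar L] =i pred0.

Local Notation LC := (L * algC)%type.
Implicit Types (S : subringClosed LC) (x : L) (b : algC).

Definition functional S := forall b, (0, b) \in S -> b = 0.

Lemma functional_inj S x b b' :
  functional S -> (x, b) \in S -> (x, b') \in S -> b = b'.
Proof.
move=> fS Sb Sb'; apply/eqP; rewrite -subr_eq0; apply/eqP/fS.
by rewrite -(subrr x); apply: rpredB Sb Sb'.
Qed.

(** Exactly what sending [x] to [b] requires to be well defined. *)
Definition image_root S x b := forall Q : {poly LC}, Q \is a polyOver S ->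
  root (map_poly fst Q) x -> root (map_poly snd Q) b.

Lemma horner_pair (Q : {poly LC}) x b :
  Q.[(x, b)] = ((map_poly fst Q).[x], (map_poly snd Q).[b]).
Proof. by rewrite [LHS]surjective_pairing -!horner_map. Qed.

Lemma functional_adjoin S x b : functional S -> image_root S x b ->
  exists S', [/\ functional S', {subset S <= S'} & (x, b) \in S'].
Proof.
move=> fS rS; pose T : {pred LC} := fun z =>
  `[< exists2 Q : {poly LC}, Q \is a polyOver S & z = Q.[(x, b)] >].
have TP z : reflect (exists2 Q : {poly LC}, Q \is a polyOver S & z = Q.[(x, b)])
                    (z \in T) by apply: asboolP.
have Tr : subring_closed T.
  split=> [|u v /TP[P SP ->] /TP[Q SQ ->]|u v /TP[P SP ->] /TP[Q SQ ->]];
    apply/TP.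
  - by exists 1; rewrite ?rpred1 // hornerC.
  - by exists (P - Q); rewrite ?rpredB // hornerD hornerN.
  - by exists (P * Q); rewrite ?rpredM // hornerM.
pose Tm := GRing.isSubringClosed.Build LC T Tr.
pose S' : subringClosed LC := HB.pack T Tm.
exists S'; split=> [b' /TP[Q SQ]|z Sz|].
- rewrite horner_pair => -[Qx ->]; apply/rootP/rS => //.
  by apply/rootP.
- by apply/TP; exists z%:P; rewrite ?polyOverC // hornerC.
- by apply/TP; exists 'X; rewrite ?polyOverX // hornerX.
Qed.

(** Every [b] is excluded by some polynomial; Q + n Q' excludes finitely many at once, for a natural
    [n] missing the roots of the nonzero linear polynomials [h c]. *)
Lemma avoid_common_roots (S : subringClosed LC) x (rs : seq algC) :
    (forall b, ~ image_root S x b) ->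
  exists Q : {poly LC}, [/\ Q \is a polyOver S, root (map_poly fst Q) x
    & forall b, b \in rs -> ~~ root (map_poly snd Q) b].
Proof.
move=> none; elim: rs => [|b rs [Q [SQ Qx Qrs]]].
  by exists 0; rewrite rpred0 rmorph0 root0.
have [Q' SQ' [Q'x Q'b]] : exists2 Q' : {poly LC}, Q' \is a polyOver S &
    root (map_poly fst Q') x /\ ~~ root (map_poly snd Q') b.
  apply: contrapT => nQ'; apply: (none b) => Q' SQ' Q'x.
  by apply/negPn/negP => nb; apply: nQ'; exists Q'.
pose h c : {poly algC} := (map_poly snd Q).[c]%:P + (map_poly snd Q').[c] *: 'X.
have h0 c : c \in b :: rs -> h c != 0.
  move=> cin; apply/eqP => /polyP e.
  have := e 0%N; have := e 1%N.
  rewrite !coefD !coefC !coefZ !coefX /= ?coef0 mulr1 mulr0 add0r addr0 => e1 e0.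
  move: cin; rewrite inE => /predU1P[cb|/Qrs]; last by rewrite /root e0 eqxx.
  by move: Q'b; rewrite -cb /root e1 eqxx.
have [n hn] : exists n : nat, forall c, c \in b :: rs -> (h c).[n%:R] != 0.
  pose H := \prod_(c <- b :: rs) h c.
  have H0 : H != 0 by rewrite prodf_seq_neq0; apply/allP => c /h0.
  apply: contrapT => none'; move/eqP: H0; apply.
  apply: (@poly_nat_roots_eq0 _ (pchar_num _) _ xpredT) => [m|m _];
    first by exists m.
  apply/eqP/negPn/negP => Hm; apply: none'; exists m => c cin.
  by move: Hm; rewrite horner_prod prodf_seq_neq0 => /allP/(_ c cin).
exists (Q + Q' *+ n); split.
- by rewrite rpredD ?rpredMn.
- by rewrite rmorphD rmorphMn /root hornerD hornerMn (rootP Qx) (rootP Q'x) mul0rn addr0.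
move=> c /hn; rewrite /h hornerD hornerC hornerZ hornerX mulr_natr.
by rewrite rmorphD rmorphMn /root hornerD hornerMn.
Qed.

(* Lying over: if every candidate image were ruled out, some polynomial [Q]
   vanishing at [x] would have an image coprime to that of [P], and the
   resultant of [P] and [Q] would contradict functionality. *)
Lemma image_root_exists S x (P : {poly LC}) : functional S ->
    P \is monic -> P \is a polyOver S -> root (map_poly fst P) x ->
  exists b, image_root S x b.
Proof.
move=> fS mP SP Px; apply: contrapT => none.
have {}none b : ~ image_root S x b by move=> rb; apply: none; exists b.
have [rs] := closed_field_poly_normal (map_poly (snd : LC -> algC) P).
rewrite (monicP (monic_map _ mP)) scale1r => Drs.
have [Q [SQ Qx Qrs]] := avoid_common_roots rs none.
have szP : (1 < size P)%N.
  rewrite ltnNge; apply/negP => /size1_polyC PC; move: Px.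
  have := monicP mP; rewrite PC lead_coefC => ->.
  by rewrite rmorph1 (negPf (root1 _)).
(* This makes [Q] monic without changing its values at roots of [P]; both being monic, the resultant
   commutes with the projections. *)
pose Q1 := Q + P * 'X^(size Q).
have mPX : P * 'X^(size Q) \is monic by rewrite monicMl ?monicXn.
have szPXE : size (P * 'X^(size Q)) = (size P + size Q)%N.
  by rewrite size_monicM ?monic_neq0 ?monicXn // size_polyXn addnS.
have szPX : (size Q < size (P * 'X^(size Q))%R)%N by rewrite szPXE; lia.
have mQ1 : Q1 \is monic by rewrite monicE lead_coefDr // -monicE.
have szQ1 : (1 < size Q1)%N by rewrite /Q1 addrC size_polyDl // szPXE; lia.
have SQ1 : Q1 \is a polyOver S by rewrite rpredD // rpredM // rpredX ?polyOverX.
have [[u v] /= _ Dres] := resultant_in_ideal szP szQ1.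
have : (0, (resultant P Q1).2) \in S.
  have <- : (resultant P Q1).1 = 0.
    have := congr1 (fun R => (map_poly (fst : LC -> L) R).[x]) Dres.
    rewrite map_polyC hornerC /= => ->.
    rewrite rmorphD !rmorphM /= hornerD !hornerM (rootP Px) mulr0 add0r.
    by rewrite rmorphD rmorphM /= hornerD hornerM (rootP Qx) (rootP Px) mul0r addr0 mulr0.
  by rewrite -surjective_pairing; apply: resultant_closed.
move/fS => /= res0.
have := resultant_map (g := snd) (p := P) (q := Q1).
rewrite /= (monicP mP) (monicP mQ1) /= oner_eq0 => /(_ isT isT).
rewrite res0 => /esym/eqP; rewrite resultant_eq0 => gt1.
have /closed_rootP[b] : size (gcdp (map_poly snd P) (map_poly snd Q1)) != 1%N.
  by rewrite neq_ltn gt1 orbT.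
rewrite root_gcd => /andP[Pb Q1b].
have : b \in rs by rewrite -root_prod_XsubC -Drs.
move/Qrs/negP; apply; move: Q1b; rewrite rmorphD rmorphM /= /root.
by rewrite hornerD hornerM (rootP Pb) mul0r addr0.
Qed.

Definition integral_over S x := exists P : {poly LC},
  [/\ P \is monic, P \is a polyOver S & root (map_poly fst P) x].

Lemma functional_extend S (xs : seq L) : functional S ->
    (forall x, x \in xs -> integral_over S x) ->
  exists S', [/\ functional S', {subset S <= S'}
    & forall x, x \in xs -> exists b, (x, b) \in S'].
Proof.
move=> fS; elim: xs => [|x xs IH] intx.
  by exists S; split=> // x; rewrite in_nil.
have [y yxs|S1 [fS1 sS1 xsP]] := IH; first by apply: intx; rewrite inE yxs orbT.
have [P [mP SP Px]] := intx x (mem_head _ _).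
have [|b rb] := image_root_exists fS1 mP _ Px.
  by apply: polyOverS SP.
have [S' [fS' sS' S'x]] := functional_adjoin fS1 rb.
exists S'; split=> // [z /sS1/sS' //|y].
rewrite inE => /predU1P[->|/xsP[c Sc]]; first by exists b.
by exists c; apply: sS'.
Qed.

End PartialMorphisms.

Section Specialization.
Variable L : closedFieldType.
Hypothesis charL0 : [pchar L] =i pred0.

Local Notation LC := (L * algC)%type.
Implicit Types (S : subringClosed LC).

Definition separated_by_rat (A : idomainType) :=
  forall a : A, a != 0 -> exists phi : {rmorphism A -> rat}, phi a != 0.

Definition algebraic_over (A : idomainType) (ev : {rmorphism A -> L}) (y : L) :=
  exists2 P : {poly A}, P != 0 & root (map_poly ev P) y.

Lemma intr_inj_pchar0 : injective (intr : int -> L).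
Proof.
apply: raddf_inj => n /=; case: (intP n) => // m /eqP.
  by rewrite -pmulrn ((pcharf0P L).1 charL0).
by rewrite mulrNz oppr_eq0 -pmulrn ((pcharf0P L).1 charL0).
Qed.

(** [A] is an iterated polynomial ring over the integers on a transcendence basis taken from [ys]: a
    transcendental [y] becomes a new variable, which can be sent to a natural number off the roots
    of a given polynomial. *)
Lemma generic_domain_exists (ys : seq L) :
  exists (A : idomainType) (ev : {rmorphism A -> L}),
    [/\ injective ev, separated_by_rat A
      & forall y, y \in ys -> algebraic_over ev y].
Proof.
elim: ys => [|y ys [A [ev [ev_inj sepA algA]]]].
  exists int, (intr : {rmorphism int -> L}); split=> //;
    first exact: intr_inj_pchar0.
  by move=> a a0; exists (intr : {rmorphism int -> rat}); rewrite intr_eq0.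
case: (pselect (algebraic_over ev y)) => [algy|transy].
  exists A, ev; split=> // z; rewrite inE => /predU1P[->//|]; exact: algA.
pose ev' : {rmorphism {poly A} -> L} := horner_eval y \o map_poly ev.
have ev'X : ev' 'X = y by rewrite /ev' /= /horner_eval map_polyX hornerX.
have ev'C a : ev' a%:P = ev a by rewrite /ev' /= /horner_eval map_polyC hornerC.
exists {poly A}, ev'; split.
- apply: raddf_inj => P evP; apply/eqP/negPn/negP => P0.
  by apply: transy; exists P => //; apply/rootP.
- move=> P P0; have [|phi phi0] := sepA (lead_coef P);
  first by rewrite lead_coef_eq0.
  have [n Pn] : exists n : nat, (map_poly phi P).[n%:R] != 0.
    apply: contrapT => none; suff : map_poly phi P = 0.
      move/(congr1 (fun Q : {poly rat} => Q`_(size P).-1)).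
      by rewrite coef_map coef0; apply/eqP.
    apply: (@poly_nat_roots_eq0 _ (pchar_num _) _ xpredT) => [m|m _];
      first by exists m.
    by apply/eqP/negPn/negP => nz; apply: none; exists m.
  pose psi : {rmorphism {poly A} -> rat} := horner_eval n%:R \o map_poly phi.
  by exists psi.
move=> z; rewrite inE => /predU1P[->|zys].
  exists ('X - 'X%:P); first by apply: monic_neq0; apply: monicXsubC.
  by rewrite map_polyXsubC root_XsubC; apply/eqP/esym/ev'X.
have [P P0 Pz] := algA z zys; exists (map_poly polyC P).
  by rewrite map_polyC_eq0.
by rewrite -map_poly_comp (eq_map_poly (_ : _ =1 ev)) // => a; apply: ev'C.
Qed.

Section FractionGraph.
Variables (A : idomainType) (ev : {rmorphism A -> L}) (phi : {rmorphism A -> rat}).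
Hypothesis ev_inj : injective ev.

Let frac (p q : A) : LC := (ev p / ev q, ratr (phi p) / ratr (phi q)).

Let ev0 q : phi q != 0 -> ev q != 0.
Proof.
by apply: contraNneq => e;
  rewrite (ev_inj (etrans e (esym (rmorph0 ev)))) rmorph0.
Qed.

Let phi0 q : phi q != 0 -> ratr (phi q) != 0 :> algC.
Proof. by rewrite fmorph_eq0. Qed.

(* The localisation of [A] at the kernel of [phi], mapped to [algC] by [phi]. *)
Lemma fraction_graph_exists : exists S, functional S /\
  forall z, z \in S <->
    exists p q, phi q != 0 /\ z = (ev p / ev q, ratr (phi p) / ratr (phi q)).
Proof.
pose T : {pred LC} := fun z => `[< exists p q, phi q != 0 /\ z = frac p q >].
have TP z : reflect (exists p q, phi q != 0 /\ z = frac p q) (z \in T) by apply: asboolP.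
have Tr : subring_closed T.
  split=> [|u v /TP[p [q [q0 ->]]] /TP[p' [q' [q'0 ->]]]
           |u v /TP[p [q [q0 ->]]] /TP[p' [q' [q'0 ->]]]]; apply/TP.
  - by exists 1, 1; rewrite /frac !rmorph1 oner_eq0 !divr1.
  - exists (p * q' - p' * q), (q * q'); rewrite rmorphM mulf_neq0 //;
    split=> //.
    have [e0 e'0 f0 f'0] := And4 (ev0 q0) (ev0 q'0) (phi0 q0) (phi0 q'0).
    rewrite /frac; congr (_, _); rewrite !(rmorphB, rmorphM) /=; field.
      by rewrite e0 e'0.
    by rewrite f0 f'0.
  - exists (p * p'), (q * q'); rewrite rmorphM mulf_neq0 //; split=> //.
    have [e0 e'0 f0 f'0] := And4 (ev0 q0) (ev0 q'0) (phi0 q0) (phi0 q'0).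
    rewrite /frac; congr (_, _); rewrite !rmorphM /=; field.
      by rewrite e0 e'0.
    by rewrite f0 f'0.
pose Tm := GRing.isSubringClosed.Build LC T Tr.
pose S : subringClosed LC := HB.pack T Tm.
exists S; split=> [b /TP[p [q [q0 [/esym/eqP]]]]|z].
  2: by split=> [/TP|Tz] //; apply/TP.
rewrite mulf_eq0 invr_eq0 (negPf (ev0 q0)) orbF => /eqP ep ->.
by rewrite (ev_inj (etrans ep (esym (rmorph0 ev)))) !rmorph0 mul0r.
Qed.

End FractionGraph.

(* A torsion root of a rational polynomial of size at most [d] has bounded
   order, since there are only finitely many of them. *)
Lemma torsion_bounded_degree (d : nat) : exists2 R, (0 < R)%N &
  forall (b : algC) (P : {poly rat}), torsion b -> P != 0 -> (size P <= d)%N ->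
    root (map_poly ratr P) b -> b ^+ R = 1.
Proof.
have [Om OmP] := Aint_bounded_finite d 1.
have [R R0 RP] : exists2 R, (0 < R)%N & forall b, b \in Om -> torsion b -> b ^+ R = 1.
  elim: {OmP}Om => [|c Om [R R0 RP]]; first by exists 1%N.
  case: (pselect (torsion c)) => [[n n0 cn]|ntc]; last first.
    by exists R => // b; rewrite inE => /predU1P[->|]; [|apply: RP].
  exists (n * R)%N => [|b]; first by rewrite muln_gt0 n0.
  rewrite inE => /predU1P[-> _|Omb tb]; first by rewrite exprM cn expr1n.
  by rewrite mulnC exprM RP // expr1n.
exists R => // b P tb P0 szP Pb; apply: RP => //; apply: OmP;
  first exact: torsion_Aint.
  move=> C uC CP; apply: leq_trans szP;
    rewrite -(size_map_poly (ratr : rat -> algC)).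
  apply/ltnW/max_poly_roots => //; first by rewrite map_poly_eq0.
  apply/allP => c /CP[nu <-].
  have -> : map_poly (ratr : rat -> algC) P = map_poly nu (map_poly ratr P).
    by rewrite -map_poly_comp; apply: eq_map_poly => q /=; rewrite fmorph_rat.
  by rewrite fmorph_root.
by move=> nu; rewrite torsion_norm //; apply: torsion_rmorph.
Qed.

Definition specializes A (phi : {rmorphism A -> rat}) (ev : {rmorphism A -> L}) S :=
  forall p q, phi q != 0 -> (ev p / ev q, ratr (phi p) / ratr (phi q)) \in S.

Lemma good_specialization (A : idomainType) (ev : {rmorphism A -> L}) (y : L) :
    injective ev -> algebraic_over ev y ->
  exists2 a : A, a != 0 & forall (phi : {rmorphism A -> rat}) S, phi a != 0 ->
    functional S -> specializes phi ev S ->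
    integral_over S y /\ forall b, (y, b) \in S ->
      (y != 0 -> b != 0) /\ (~ torsion y -> ~ torsion b).
Proof.
move=> ev_inj [P1 P1_0 P1y].
have ev_eq0 a : (ev a == 0) = (a == 0) by rewrite -(rmorph0 ev) (inj_eq ev_inj).
have [P [P0 Py minP]] : exists P : {poly A}, [/\ P != 0, root (map_poly ev P) y
    & forall Q : {poly A}, Q != 0 -> root (map_poly ev Q) y -> (size P <= size Q)%N].
  have ex : exists n, `[< exists Q : {poly A},
      [/\ Q != 0, root (map_poly ev Q) y & size Q = n] >].
    by exists (size P1); apply/asboolP; exists P1.
  have [n /asboolP[P [P0 Py <-]] nmin] := ex_minnP ex.
  by exists P; split=> // Q Q0 Qy; apply: nmin; apply/asboolP; exists Q.
have [R R0 RP] := torsion_bounded_degree (size P).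
pose r := resultant P ('X^R - 1).
have XR0 : 'X^R - 1 != 0 :> {poly A} by rewrite monic_neq0 // monicXnsubC.
have evXR : map_poly ev ('X^R - 1) = 'X^R - 1 by rewrite rmorphB /= map_polyXn rmorph1.
(* A common factor of [P] and X^R - 1 gives u P = v (X^R - 1) with [v] shorter than [P], so nonzero
   at [y] by minimality; then y^R = 1. *)
have r_neq0 : ~ torsion y -> r != 0.
  move=> nty; rewrite /r resultant_eq0 -leqNgt leq_eqVlt ltnS leqn0.
  rewrite size_poly_eq0 gcdp_eq0 (negPf P0) orbF.
  apply/negPn/negP => /(Bezout_coprimepPn P0 XR0)[[u v] /= /and3P[_ v0 szv] e].
  have v_neq0 : v != 0 by rewrite -size_poly_gt0.
  have vy : ~~ root (map_poly ev v) y.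
    by apply/negP => /(minP v v_neq0); rewrite leqNgt szv.
  have := congr1 (fun Q => (map_poly ev Q).[y]) e.
  rewrite !rmorphM /= !hornerM (rootP Py) mulr0 => /esym/eqP.
  rewrite mulf_eq0 -rootE (negPf vy) /= evXR hornerD hornerN hornerXn hornerC.
  rewrite subr_eq0 => /eqP yR.
  by apply: nty; exists R.
have P00 : y != 0 -> P`_0 != 0.
  apply: contraNN => /eqP P00.
  have /factor_theorem[Q DQ] : root P 0 by rewrite /root horner_coef0 P00.
  rewrite subr0 in DQ.
  have Q0 : Q != 0 by apply: contraNneq P0 => Q0; rewrite DQ Q0 mul0r.
  have szP : size P = (size Q).+1 by rewrite DQ size_mulX.
  move: Py; rewrite DQ rmorphM /= map_polyX rootM rootX => /orP[/(minP Q Q0)|//].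
  by rewrite szP ltnn.
(* Inverting the leading coefficient makes [y] integral; the constant term keeps the image of [y]
   nonzero; a torsion image would be a common root of the images of [P] and X^R - 1, killing [r]. *)
pose a := lead_coef P * ((if y != 0 then P`_0 else 1) *
  if pselect (torsion y) then 1 else r).
exists a.
  rewrite /a !mulf_neq0 ?lead_coef_eq0 //.
    by case: ifP => [/P00|]; rewrite ?oner_eq0.
  by case: pselect => /= [_|/r_neq0]; rewrite ?oner_eq0.
move=> phi S; rewrite /a !rmorphM !mulf_eq0 !negb_or => /and3P[lc0 const0 res0] fS spS.
have inS p : (ev p, ratr (phi p)) \in S.
  by have := spS p 1; rewrite !rmorph1 !divr1 oner_eq0; apply.
have image_root_A b (Q : {poly A}) : (y, b) \in S -> root (map_poly ev Q) y ->
    root (map_poly ratr (map_poly phi Q)) b.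
  move=> Sb Qy; pose Q' : {poly LC} := \poly_(i < size Q) (ev Q`_i, ratr (phi Q`_i)).
  have Q'1 : map_poly fst Q' = map_poly ev Q.
    apply/polyP => i; rewrite !coef_map coef_poly /=.
    by case: ltnP => //= iQ; rewrite nth_default // rmorph0.
  have Q'2 : map_poly snd Q' = map_poly ratr (map_poly phi Q).
    apply/polyP => i; rewrite !coef_map coef_poly /=.
    by case: ltnP => //= iQ; rewrite nth_default // !rmorph0.
  apply/rootP/fS; rewrite -(rootP Qy) -Q'1 -Q'2 -horner_pair.
  apply: rpred_horner => //; apply/polyOverP => i; rewrite coef_poly.
  by case: ifP => _; rewrite ?rpred0.
split.
  pose M : {poly LC} := \poly_(i < size P)
    (ev P`_i / ev (lead_coef P), ratr (phi P`_i) / ratr (phi (lead_coef P))).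
  have elc0 : ev (lead_coef P) != 0 by rewrite ev_eq0 lead_coef_eq0.
  have M1 : M`_(size P).-1 = 1.
    rewrite coef_poly prednK ?size_poly_gt0 // leqnn -/(lead_coef P).
    by rewrite !divff // fmorph_eq0.
  have szM : size M = size P.
    rewrite size_poly_eq // -/(lead_coef P) divff //.
    by apply/eqP => -[/eqP]; rewrite oner_eq0.
  exists M; split.
  - by rewrite monicE /lead_coef szM M1.
  - apply/polyOverP => i; rewrite coef_poly.
    by case: ifP => _; rewrite ?rpred0 //; apply: spS.
  have -> : map_poly fst M = (ev (lead_coef P))^-1 *: map_poly ev P.
    apply/polyP => i; rewrite coefZ !coef_map coef_poly /= mulrC.
    by case: ltnP => //= iP; rewrite nth_default // rmorph0 mulr0.
  by rewrite rootZ ?invr_eq0.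
move=> b Sb; have Pb := image_root_A b P Sb Py; split=> [y0|nty tb].
  apply: contraNneq const0 => b0; rewrite y0.
  by move: Pb; rewrite b0 /root horner_coef0 !coef_map fmorph_eq0.
move: res0; case: pselect => /= [/nty[]|_] /negP; apply.
have phiP0 : map_poly phi P != 0.
  by apply: contraNneq lc0 => e; rewrite -(coef_map phi) e coef0.
have bR : b ^+ R = 1.
  apply: (RP b _ tb phiP0 _ Pb).
  by apply: leq_trans (size_poly _ _) _.
have [szP1 szXR] : (1 < size P)%N /\ (1 < size ('X^R - 1 : {poly A})%R)%N.
  split; last by rewrite size_XnsubC.
  rewrite -(size_map_inj_poly ev_inj (rmorph0 ev)); apply: root_size_gt1 Py.
  by rewrite map_poly_eq0_id0 // ev_eq0 lead_coef_eq0.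
have [[u v] /= _ Dr] := resultant_in_ideal szP1 szXR.
have := congr1 (fun Q => (map_poly ratr (map_poly phi Q)).[b] : algC) Dr.
rewrite -/r !map_polyC hornerC /= !rmorphD /= !rmorphM /= hornerD !hornerM.
rewrite (rootP Pb) mulr0 add0r.
have -> : map_poly ratr (map_poly phi ('X^R - 1)) = 'X^R - 1 :> {poly algC}.
  by rewrite !rmorphB /= !map_polyXn !rmorph1.
rewrite hornerD hornerN hornerXn hornerC bR subrr mulr0 => /eqP.
by rewrite fmorph_eq0.
Qed.

Theorem specialization (ys : seq L) : exists S, [/\ functional S,
    forall q : rat, (ratr q, ratr q) \in S
  & forall y, y \in ys -> exists b, [/\ (y, b) \in S, y != 0 -> b != 0
      & ~ torsion y -> ~ torsion b]].
Proof.
have [A [ev [ev_inj sepA algA]]] := generic_domain_exists ys.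
have [a a0 aP] : exists2 a : A, a != 0 & forall (phi : {rmorphism A -> rat}) S,
    phi a != 0 -> functional S -> specializes phi ev S -> forall y, y \in ys ->
    integral_over S y /\ forall b, (y, b) \in S ->
      (y != 0 -> b != 0) /\ (~ torsion y -> ~ torsion b).
  elim: ys algA => [|y ys IH] algA.
    by exists 1 => [|phi S _ _ _ y]; rewrite ?oner_eq0.
  have [|a a0 aP] := IH; first by move=> z zys; apply: algA;
    rewrite inE zys orbT.
  have [c c0 cP] := good_specialization ev_inj (algA y (mem_head _ _)).
  exists (c * a) => [|phi S]; first by rewrite mulf_neq0.
  rewrite rmorphM mulf_eq0 negb_or => /andP[pc pa] fS sS z.
  by rewrite inE => /predU1P[->|zys];
    [exact: cP pc fS sS | exact: aP pa fS sS z zys].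
have [phi phi0] := sepA a a0.
have [S0 [fS0 S0P]] := fraction_graph_exists phi ev_inj.
have sp0 : specializes phi ev S0 by move=> p q q0; apply/S0P; exists p, q.
have [y yys|S [fS sS ysP]] := functional_extend (xs := ys) fS0.
  by have [] := aP phi S0 phi0 fS0 sp0 y yys.
exists S; split=> // [q|y yys].
  have := sp0 (numq q)%:~R (denq q)%:~R; rewrite !rmorph_int.
  by move=> H; apply: sS; apply: H; rewrite intr_eq0 denq_eq0.
have [b Sb] := ysP y yys; exists b.
have sp : specializes phi ev S by move=> p q q0; apply/sS/sp0.
have [_ /(_ b Sb)[y0 nty]] := aP phi S phi0 fS sp y yys.
by split.
Qed.

End Specialization.

(** * The theorem over an arbitrary field *)

Lemma pair_sum (R1 R2 : nmodType) (J : Type) (r : seq J) (Q : pred J)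
    (u : J -> R1) (v : J -> R2) :
  \sum_(j <- r | Q j) (u j, v j) = (\sum_(j <- r | Q j) u j, \sum_(j <- r | Q j) v j).
Proof. by rewrite [LHS]surjective_pairing !raddf_sum. Qed.

Theorem twisted_zeros_list (L : closedFieldType) (charL0 : [pchar L] =i pred0)
    (I : finType) (lam : I -> L) (f : I -> {poly L}) :
    (0 < #|I|)%N -> (forall i, lam i != 0) ->
    (forall i j, i != j -> ~ torsion (lam i / lam j)) -> (forall i, f i != 0) ->
  exists s : seq rat, forall a x, (forall i, twisted_power (lam i) a (x i)) ->
    \sum_i (f i).[ratr a] * x i = 0 -> a \in s.
Proof.
move=> I0 lam0 nondeg f0.
pose ratio (ij : I * I) := lam ij.1 / lam ij.2.
(* Inverses are listed so that negative powers stay in the domain [S], and ratios so that their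
   images remain non-torsion. *)
pose ys := [seq lam i | i : I] ++ [seq (lam i)^-1 | i : I]
  ++ [seq ratio ij | ij : I * I] ++ flatten [seq (f i : seq L) | i : I].
have [S [fS ratS ysP]] := specialization charL0 ys.
have ex_h y : exists b, y \in ys ->
    [/\ (y, b) \in S, y != 0 -> b != 0 & ~ torsion y -> ~ torsion b].
  case: (boolP (y \in ys)) => [/ysP[b bP]|_]; first by exists b.
  by exists 0.
have [h hP] := choice ex_h.
have lam_in i : lam i \in ys by rewrite mem_cat map_f ?mem_enum.
have inv_in i : (lam i)^-1 \in ys.
  by rewrite !mem_cat (map_f (fun i => (lam i)^-1)) ?mem_enum // orbT.
have ratio_in i j : lam i / lam j \in ys.
  by rewrite !mem_cat (map_f ratio (x := (i, j))) ?mem_enum // !orbT.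
have coef_in i k : (k < size (f i))%N -> (f i)`_k \in ys.
  move=> kf; rewrite !mem_cat; apply/or4P/Or44/flattenP.
  exists (f i : seq L); last exact: mem_nth.
  by apply: (map_f (fun i => f i : seq L)); rewrite mem_enum.
pose lam' i := h (lam i).
pose f' i := \poly_(k < size (f i)) h (f i)`_k.
have lam'0 i : lam' i != 0 by have [_ /(_ (lam0 i))] := hP _ (lam_in i).
have S1 : (1, 1) \in S := rpred1 S.
have invS i : ((lam i)^-1, (lam' i)^-1) \in S.
  have [Sl _ _] := hP _ (lam_in i); have [Si _ _] := hP _ (inv_in i).
  have e : lam' i * h (lam i)^-1 = 1.
    apply: (functional_inj fS _ S1).
    by rewrite -{1}(divff (lam0 i)); apply: rpredM Sl Si.
  suff <- : h (lam i)^-1 = (lam' i)^-1 by [].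
  by apply: (mulfI (lam'0 i)); rewrite e divff.
have powS i (k : int) : (lam i ^ k, lam' i ^ k) \in S.
  have [Sl _ _] := hP _ (lam_in i).
  have pow_nat (u : L * algC) n : u \in S -> (u.1 ^+ n, u.2 ^+ n) \in S.
    move=> Su; have -> : (u.1 ^+ n, u.2 ^+ n) = u ^+ n.
      by rewrite [RHS]surjective_pairing !rmorphXn.
    exact: rpredX.
  case: (intP k) => [|n|n]; rewrite ?expr0z //.
    exact: (pow_nat (lam i, lam' i) n.+1).
  by rewrite -!exprnN -!exprVn; exact: (pow_nat ((lam i)^-1, (lam' i)^-1) n.+1).
have nondeg' i j : i != j -> ~ torsion (lam' i / lam' j).
  move=> ij; have [Sr _ /(_ (nondeg i j ij))] := hP _ (ratio_in i j).
  have [Si _ _] := hP _ (lam_in i).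
  suff <- : h (lam i / lam j) = lam' i / lam' j by [].
  by apply: (functional_inj fS Sr); apply: rpredM Si (invS j).
have f'0 i : f' i != 0.
  have fi : (0 < size (f i))%N by rewrite size_poly_gt0.
  apply/eqP => /(congr1 (fun Q : {poly algC} => Q`_(size (f i)).-1)).
  rewrite coef0 coef_poly prednK // leqnn; apply/eqP.
  have /coef_in/hP[_ + _] : ((size (f i)).-1 < size (f i))%N by rewrite prednK.
  by apply; rewrite -/(lead_coef (f i)) lead_coef_eq0.
have [s sP] := algC_twisted_zeros lam'0 nondeg' f'0 I0.
exists s => a x tx sum0; set l := `|denq a|%N.
have l0 : (0 < l)%N := absz_denq_gt0 a.
have [r r0 xr] := common_torsion_exponent tx.
have xlr i : x i ^+ (l * r) = (lam i ^ numq a) ^+ r.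
  rewrite exprM -[in LHS](divfK (expfz_neq0 (numq a) (lam0 i)) (x i ^+ l)).
  by rewrite exprMn xr mul1r.
pose c i : L * algC := ((lam i ^ numq a) ^+ r, (lam' i ^ numq a) ^+ r).
have cS i : c i \in S.
  have -> : c i = (lam i ^ numq a, lam' i ^ numq a) ^+ r.
    by rewrite [RHS]surjective_pairing !rmorphXn.
  by apply: rpredX; apply: powS.
(* Each [x i] has a power in the domain of [S], so it is integral; the extension depends on the
   zero, but [lam'], [f'] and the list [s] do not. *)
have [_ /mapP[i _ ->]|S' [fS' sS' xS']] := functional_extend (xs := [seq x i | i : I]) fS.
  exists ('X^(l * r) - (c i)%:P); split.
  - by rewrite monicXnsubC // muln_gt0 l0.
  - by rewrite rpredB ?rpredX ?polyOverX // polyOverC.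
  rewrite rmorphB /= map_polyXn map_polyC /root hornerD hornerN hornerXn hornerC.
  by rewrite /= xlr subrr.
have ex_x' i : exists b, (x i, b) \in S' by apply: xS'; rewrite map_f ?mem_enum.
have [x' x'P] := choice ex_x'.
apply: (sP a x') => [i|].
  exists r => //; rewrite expr_div_n -exprM.
  suff -> : x' i ^+ (l * r) = (lam' i ^ numq a) ^+ r.
    by rewrite divff // expf_neq0 // expfz_neq0.
  apply: (functional_inj fS' _ (sS' _ (cS i))); rewrite -xlr.
  have -> : (x i ^+ (l * r), x' i ^+ (l * r)) = (x i, x' i) ^+ (l * r).
    by rewrite [RHS]surjective_pairing !rmorphXn.
  exact: rpredX.
apply: fS'; rewrite -sum0 -pair_sum; apply: rpred_sum => i _.
apply: (@rpredM _ _ ((f i).[ratr a], (f' i).[ratr a]) (x i, x' i) _ (x'P i)).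
rewrite horner_coef horner_poly -pair_sum; apply: rpred_sum => k _.
apply: sS'; apply: (@rpredM _ _ ((f i)`_k, h (f i)`_k) (ratr a ^+ k, ratr a ^+ k)).
  by have [] := hP _ (coef_in i k (ltn_ord k)).
have -> : (ratr a ^+ k, ratr a ^+ k) = (ratr a, ratr a) ^+ k :> L * algC.
  by rewrite [RHS]surjective_pairing !rmorphXn.
exact: rpredX.
Qed.

Section ClosedForm.
Variables (K : fieldType) (L : closedFieldType) (iota : {rmorphism K -> L}).
Hypothesis charL0 : [pchar L] =i pred0.
Variable U : int -> K.

Lemma torsion_is_root_of_unity (x : L) : torsion x <-> is_root_of_unity x.
Proof. by split=> -[n n0 /unity_rootP xn]; exists n => //;
  apply/unity_rootP. Qed.

Lemma charpoly_root_neq0 m (a : 'I_m -> K) (x : L) :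
  recurrence U a -> root (map_poly iota (charpoly a)) x -> x != 0.
Proof.
case=> a0 _; apply: contraL => /eqP ->.
rewrite -(rmorph0 iota) fmorph_root /root /charpoly hornerD hornerN hornerXn.
rewrite horner_sum; case: m a a0 => [|m] a a0.
  by rewrite big_ord0 subr0 expr0 oner_eq0.
rewrite expr0n sub0r oppr_eq0 big_ord_recl big1 => [|i _].
  by rewrite hornerZ hornerXn expr0 mulr1 addr0 a0.
by rewrite hornerZ hornerXn expr0n mulr0.
Qed.

Lemma characteristic_roots_neq0 s (lam : 'I_s -> L) i :
  characteristic_roots iota U lam -> lam i != 0.
Proof.
move=> [m [a [[rec _] _ rootP]]].
by apply: (charpoly_root_neq0 rec); apply/rootP; exists i.
Qed.

(** A twisted zero carries its own closed form, to be matched with a fixed one. The difference of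
    the two, indexed by the union of their roots, vanishes at all naturals, so [exp_poly_eq0]
    applies. *)
Lemma closed_form_terms s s' (lam : 'I_s -> L) (lam' : 'I_s' -> L) f f' :
    closed_form iota U lam f -> closed_form iota U lam' f' ->
  forall i, exists j, lam' j = lam i /\ f' j = f i.
Proof.
move=> [cl f0 _ Uf] [cl' f'0 _ Uf'] i0.
have lam_inj : injective lam by case: cl => m [a []].
have lam'_inj : injective lam' by case: cl' => m [a []].
pose vals := [seq lam i | i : 'I_s] ++ [seq lam' j | j : 'I_s'].
have in1 i : lam i \in vals by rewrite mem_cat map_f ?mem_enum.
have in2 j : lam' j \in vals by rewrite mem_cat orbC map_f ?mem_enum.
pose v1 i : seq_sub vals := SeqSub (in1 i);
  pose v2 j : seq_sub vals := SeqSub (in2 j).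
pose g (v : seq_sub vals) := \sum_(i | v1 i == v) f i - \sum_(j | v2 j == v) f' j.
have vals0 (v : seq_sub vals) : val v != 0.
  have := valP v; rewrite mem_cat => /orP[] /mapP[i _ ->];
    exact: characteristic_roots_neq0.
have g0 : {in [set: seq_sub vals], forall v, g v = 0}.
  apply: (exp_poly_eq0 charL0 (lam := fun v : seq_sub vals => val v)).
  - by move=> v w _ _; apply: val_inj.
  - by move=> v _; apply: vals0.
  move=> n; transitivity (iota (U n) - iota (U n)); last exact: subrr.
  rewrite {1}Uf Uf' (partition_big v1 xpredT) //=.
  rewrite [X in _ - X](partition_big v2 xpredT) //=.
  rewrite -sumrB; apply: eq_big => [v|v _]; first by rewrite inE.
  rewrite /g hornerD hornerN !horner_sum mulrBl !mulr_suml.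
  congr (_ - _); apply: eq_bigr => i /eqP <-; by [].
have := g0 (v1 i0) (in_setT _); rewrite /g (big_pred1 i0) => [|i]; last first.
  by rewrite -val_eqE /= (inj_eq lam_inj).
case: (pickP (fun j => lam' j == lam i0)) => [j0 /eqP e|none]; last first.
  rewrite big1 => [|j]; last by rewrite -val_eqE /= none.
  by rewrite subr0 => /eqP; rewrite (negPf (f0 i0)).
rewrite (big_pred1 j0) => [|j];
  last by rewrite -val_eqE /= -e (inj_eq lam'_inj).
by move/eqP; rewrite subr_eq0 => /eqP ->; exists j0.
Qed.

Lemma closed_form_unique s s' (lam : 'I_s -> L) (lam' : 'I_s' -> L) f f' :
    closed_form iota U lam f -> closed_form iota U lam' f' ->
  exists2 h : 'I_s -> 'I_s', bijective h &
    forall i, lam' (h i) = lam i /\ f' (h i) = f i.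
Proof.
move=> cf cf'; have [h hP] := choice (closed_form_terms cf cf').
have [h' h'P] := choice (closed_form_terms cf' cf).
have lam_inj : injective lam by case: cf => -[m [a []]].
have lam'_inj : injective lam' by case: cf' => -[m [a []]].
exists h => //; exists h' => i.
  by apply: lam_inj; rewrite (h'P _).1 (hP _).1.
by apply: lam'_inj; rewrite (hP _).1 (h'P _).1.
Qed.

Lemma twisted_power_determination (l xi d : L) (r : rat) :
  l != 0 -> determination l r d -> is_root_of_unity xi -> twisted_power l r (xi * d).
Proof.
move=> l0 [mu mul ->] /torsion_is_root_of_unity txi; rewrite /twisted_power.
have mu0 : mu != 0.
  apply: contraNneq l0 => mu0; rewrite -mul mu0 -absz_denq -exprnP expr0n.
  by rewrite absz_eq0 denq_eq0.
rewrite exprMn expr_expz_swap -[mu ^+ _]/(mu ^ `|denq r|%N) absz_denq mul.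
rewrite mulfK ?expfz_neq0 //.
exact: torsionX.
Qed.

End ClosedForm.

Theorem theorem1p9 (K : fieldType) (charK0 : [pchar K] =i pred0)
    (L : closedFieldType) (iota : {rmorphism K -> L})
    (closureL : algebraic_closure iota)
    (U : int -> K) (lrsU : is_lrs U) (ndU : lrs_nondegenerate iota U) :
  finite_set (twisted_rational_zero iota U).
Proof.
have charL0 : [pchar L] =i pred0 by move=> p;
  rewrite (fmorph_pchar iota) charK0.
(* Since each twisted zero comes with a closed form, the set is empty when there is none. *)
case: (pselect (exists (s : nat) (lam : 'I_s -> L) (f : 'I_s -> {poly L}),
    closed_form iota U lam f)) => [[s [lam [f cf]]]|none]; last first.
  apply: (@sub_finite_set _ _ classical_sets.set0); last exact: finite_set0.
  by move=> r [s [lam [f [d [xi [cf _ _ _]]]]]]; case: none; exists s, lam, f.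
have [cl f0 _ Uf] := cf; have [[n Un] nondeg] := ndU.
have s0 : (0 < #|'I_s|)%N.
  rewrite card_ord lt0n; apply/eqP => s0; case/eqP: Un;
    apply: (fmorph_inj iota).
  by rewrite Uf rmorph0 big1 // => -[i lt]; exfalso; rewrite s0 in lt.
have [S SP] := @twisted_zeros_list L charL0 'I_s lam f s0
  (fun i => characteristic_roots_neq0 i cl)
  (fun i j ij t => nondeg s lam cl i j ij ((torsion_is_root_of_unity _).1 t)) f0.
apply: (@sub_finite_set _ _ [set` S]%classic); last exact: finite_seq.
move=> r [s' [lam' [f' [d [xi [cf' det tor sum0]]]]]] /=.
have [h h_bij hP] := closed_form_unique charL0 cf cf'.
apply: (SP r (fun i => xi (h i) * d (h i))) => [i|].
  rewrite -(hP i).1; apply: twisted_power_determination => //.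
  by have [cl' _ _ _] := cf'; apply: characteristic_roots_neq0 cl'.
rewrite -[RHS]sum0 [RHS](reindex h) /=; last exact: onW_bij.
by apply: eq_bigr => i _; rewrite (hP i).2; ring.
Qed.
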